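(* The representation $(\Pi'_\Psi,V_\psi)$ of $H_{B'}(\mathscr W_{\mathfrak O})$ can be extended to a projective representation of $P's(\mathscr W_{\mathfrak O})\ltimes H_{B'}(\mathscr W_{\mathfrak O})$.
   Context: $K/\mathbb Q_2$ is unramified of finite degree, $\mathfrak O$ its ring of integers, $\mathfrak m^n=2^n\mathfrak O$, $F=\mathfrak O/\mathfrak m$, $R=\mathfrak O/\mathfrak m^2$. $(\mathscr W,\langle,\rangle)$ is a symplectic $K$-space of dimension $2m$ with symplectic basis $e_i,e_i^*$, $\mathcal X=\mathrm{Span}_K\{e_i\}$, $\mathcal X^*=\mathrm{Span}_K\{e_i^*\}$; groups act on the right. $B(x+x^*,y+y^* )=\langle x,y^*\rangle$ for $x,y\in\mathcal X$, $x^*,y^*\in\mathcal X^*$, and $B'=2B$. $H_{B'}(\mathscr W)=\mathscr W\times K$ with law $(w,t)+(w',t')=(w+w',t+t'+B'(w,w'))$. $\Psi$ is a character of $K$ of level $\mathfrak m^2$ (trivial on $\mathfrak m^2$, non-trivial on $\mathfrak m$). $\mathcal L'=\mathrm{Span}_{\mathfrak O}\{2e_i,e_i^*\}$; $S_{\mathcal L'}$ is the space of locally constant compactly supported $f:\mathscr W\to\mathbb C$ with $f(l+w)=\Psi(-B'(l,w))f(w)$ for $l\in\mathcal L'$; $\Pi'_\Psi(w',t)f(w)=\Psi(t+B'(w,w'))f(w+w')$. $\mathscr W_{\mathfrak O}=\mathrm{Span}_{\mathfrak O}\{e_i,e_i^*\}$, $\mathscr W_{\mathfrak m}=2\mathscr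 W_{\mathfrak O}$, $H_{B'}(\mathscr W_{\mathfrak O})=\mathscr W_{\mathfrak O}\times\mathfrak O\subset H_{B'}(\mathscr W)$, and $V_\psi\subset S_{\mathcal L'}$ is the ($H_{B'}(\mathscr W_{\mathfrak O})$-stable) subspace of functions supported on $\mathscr W_{\mathfrak O}$. A function $q:\mathscr W_{\mathfrak O}/\mathscr W_{\mathfrak m}\to R$ is called quadratic if $q(\overline{aw})=a^2q(\overline w)$ for $a\in\mathfrak O$ and $q(w_1+w_2)-q(w_1)-q(w_2)$ is biadditive. $P's(\mathscr W)$ is the group of pairs $(g,q')$ with $g\in\mathrm{Sp}(\mathscr W)$ and $q':\mathscr W\to K$ continuous with $q'(w+w')-q'(w)-q'(w')=B'(wg,w'g)-B'(w,w')$; the law is $(g,q)(g',q')=(gg',q'')$, $q''(w)=q(w)+q'(wg)$; it acts on the right on $H_{B'}(\mathscr W)$ by $(w,t)\cdot(g,q')=(wg,t+q'(w))$. $P's(\mathscr W_{\mathfrak O})$ is the subgroup of $(g,q')$ such that $\mathscr W_{\mathfrak O}g=\mathscr W_{\mathfrak O}$, $q'(\mathscr W_{\mathfrak O})\subseteq\mathfrak O$, $q'(\mathscr W_{\mathfrak m})\subseteq\mathfrak m^2$, and the induced map $\mathscr W_{\mathfrak O}/\mathscr W_{\mathfrak m}\to\mathfrak O/\mathfrak m^2$ is a quadratic function; it acts on $H_{B'}(\mathscr W_{\mathfrak O})$. *)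

(* Defs.v *)
From HB Require Import structures.
From mathcomp Require Import all_boot all_order all_algebra all_field.
From mathcomp Require Import all_classical all_reals topology normedtype.
From mathcomp Require Import complex zify ring.
Set Implicit Arguments.
Unset Strict Implicit.
Unset Printing Implicit Defensive.
Import Order.TTheory GRing.Theory Num.Theory numFieldNormedType.Exports.
Local Open Scope classical_set_scope.
Local Open Scope ring_scope.

(* Z_2 is the inverse limit of the Z / 2 ^ n; the value at n is the
   representative in [0, 2 ^ n) of the residue modulo 2 ^ n. *)
Definition coherent2 : {pred nat -> int} :=
  fun x => `[< forall n, x n = (x n.+1 %% 2 ^+ n)%Z >].

Record Z2 := MkZ2 { digits2 :> nat -> int; _ : digits2 \in coherent2 }.
HB.instance Definition _ := [isSub for digits2].
HB.instance Definition _ := [Choice of Z2 by <:].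

Lemma Z2_eqP (x y : Z2) : (forall n, x n = y n) -> x = y.
Proof. by move=> xy; apply/val_inj/funext. Qed.

Lemma Z2_coh (x : Z2) n : x n = (x n.+1 %% 2 ^+ n)%Z.
Proof. exact: (asboolP _ (valP x)). Qed.

Lemma Z2_mod (x : Z2) n : (x n %% 2 ^+ n)%Z = x n.
Proof. by rewrite [x n]Z2_coh modz_mod. Qed.

Lemma modz2D (a : int) n k : ((a %% 2 ^+ (n + k)%N)%Z = a %[mod 2 ^+ n])%Z.
Proof.
rewrite [a in RHS](intdiv.divz_eq a (2 ^+ (n + k)%N)) exprD [2 ^+ n * _]mulrC.
by rewrite mulrA modzMDl.
Qed.

Lemma Z2_mk_subproof (f : nat -> int) :
  (forall n, (f n = f n.+1 %[mod 2 ^+ n])%Z) ->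
  (fun n => (f n %% 2 ^+ n)%Z) \in coherent2.
Proof. by move=> cf; apply/asboolP => n; rewrite -[n.+1]addn1 modz2D addn1. Qed.

Definition Z2_mk (f : nat -> int)
    (cf : forall n, (f n = f n.+1 %[mod 2 ^+ n])%Z) : Z2 :=
  MkZ2 (Z2_mk_subproof cf).

Lemma Z2_coh_mod (x : Z2) n : (x n = x n.+1 %[mod 2 ^+ n])%Z.
Proof. by rewrite {1}Z2_coh modz_mod. Qed.

Lemma Z2_add_subproof (x y : Z2) n :
  (x n + y n = x n.+1 + y n.+1 %[mod 2 ^+ n])%Z.
Proof. by rewrite -modzDm !Z2_coh_mod modzDm. Qed.

Lemma Z2_opp_subproof (x : Z2) n :
  (- x n = - x n.+1 %[mod 2 ^+ n])%Z.
Proof. by rewrite -modzNm Z2_coh_mod modzNm. Qed.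

Lemma Z2_mul_subproof (x y : Z2) n :
  (x n * y n = x n.+1 * y n.+1 %[mod 2 ^+ n])%Z.
Proof. by rewrite -modzMm !Z2_coh_mod modzMm. Qed.

Definition Z2_zero := @Z2_mk (fun=> 0) (fun=> erefl).
Definition Z2_one := @Z2_mk (fun=> 1) (fun=> erefl).
Definition Z2_add (x y : Z2) := Z2_mk (Z2_add_subproof x y).
Definition Z2_opp (x : Z2) := Z2_mk (Z2_opp_subproof x).
Definition Z2_mul (x y : Z2) := Z2_mk (Z2_mul_subproof x y).

Lemma Z2_addA : associative Z2_add.
Proof. by move=> x y z; apply: Z2_eqP => n /=; rewrite modzDmr modzDml addrA. Qed.
Lemma Z2_addC : commutative Z2_add.
Proof. by move=> x y; apply: Z2_eqP => n /=; rewrite addrC. Qed.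
Lemma Z2_add0 : left_id Z2_zero Z2_add.
Proof. by move=> x; apply: Z2_eqP => n /=; rewrite modzDml add0r Z2_mod. Qed.
Lemma Z2_addN : left_inverse Z2_zero Z2_opp Z2_add.
Proof. by move=> x; apply: Z2_eqP => n /=; rewrite modzDml addNr. Qed.

HB.instance Definition _ :=
  GRing.isZmodule.Build Z2 Z2_addA Z2_addC Z2_add0 Z2_addN.

Lemma Z2_mulA : associative Z2_mul.
Proof. by move=> x y z; apply: Z2_eqP => n /=; rewrite modzMmr modzMml mulrA. Qed.
Lemma Z2_mulC : commutative Z2_mul.
Proof. by move=> x y; apply: Z2_eqP => n /=; rewrite mulrC. Qed.
Lemma Z2_mul1 : left_id Z2_one Z2_mul.
Proof. by move=> x; apply: Z2_eqP => n /=; rewrite modzMml mul1r Z2_mod. Qed.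
Lemma Z2_mulDl : left_distributive Z2_mul Z2_add.
Proof.
by move=> x y z; apply: Z2_eqP => n /=; rewrite modzMml modzDm mulrDl.
Qed.
Lemma Z2_1neq0 : Z2_one != Z2_zero.
Proof. by apply/eqP => /(congr1 (fun x : Z2 => x 1%N)). Qed.

HB.instance Definition _ := GRing.Zmodule_isComNzRing.Build Z2
  Z2_mulA Z2_mulC Z2_mul1 Z2_mulDl Z2_1neq0.

Definition Z2_unit : {pred Z2} := fun x => `[< exists y, y * x = 1 >].

Definition Z2_inv (x : Z2) : Z2 :=
  if pselect (exists y, y * x = 1) is left ex then projT1 (cid ex) else x.

Lemma Z2_mulV : {in Z2_unit, left_inverse 1 Z2_inv *%R}.
Proof.
move=> x /asboolP ux; rewrite /Z2_inv; case: pselect => // ex.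
exact: projT2 (cid ex).
Qed.

Lemma Z2_unitPl (x y : Z2) : y * x = 1 -> Z2_unit x.
Proof. by move=> yx; apply/asboolP; exists y. Qed.

Lemma Z2_inv_out : {in [predC Z2_unit], Z2_inv =1 id}.
Proof.
move=> x /asboolP nux; rewrite /Z2_inv; case: pselect => // ex.
Qed.

HB.instance Definition _ := GRing.ComNzRing_hasMulInverse.Build Z2
  Z2_mulV Z2_unitPl Z2_inv_out.

Lemma Z2_coh_le (x : Z2) n k : (x (n + k)%N = x n %[mod 2 ^+ n])%Z.
Proof.
elim: k => [|k IH]; first by rewrite addn0.
by rewrite -IH addnS [x (n + k)%N]Z2_coh modz2D.
Qed.

Lemma dvdz_pow2 (a b : int) n k :
  (2 ^+ (n + k)%N %| a * b)%Z -> (2 ^+ n %| a)%Z || (2 ^+ k %| b)%Z.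
Proof.
rewrite !dvdzE !abszX abszM; move: `|a|%N `|b|%N => {}a {}b.
have [->|a0] := posnP a; first by rewrite dvdn0.
have [->|b0] := posnP b; first by rewrite dvdn0 orbT.
rewrite !pfactor_dvdn ?muln_gt0 ?a0 // lognM //.
by case: leqP => //= h1; case: leqP => //= h2 h; lia.
Qed.

Lemma Z2_idomain (x y : Z2) : x * y = 0 -> (x == 0) || (y == 0).
Proof.
move=> xy0; have [//|/eqP x0] := eqVneq x 0; have [//|/eqP y0] := eqVneq y 0.
have /existsNP[n xn] : ~ forall n, x n = 0.
  by move=> h; apply: x0; apply: Z2_eqP => n; rewrite h /= mod0z.
have /existsNP[k yk] : ~ forall n, y n = 0.
  by move=> h; apply: y0; apply: Z2_eqP => n'; rewrite h /= mod0z.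
have /(congr1 (fun z : Z2 => z (n + k)%N)) /= := xy0.
rewrite mod0z => /dvdz_mod0P/dvdz_pow2 /orP[] /dvdz_mod0P.
  by rewrite Z2_coh_le Z2_mod.
by rewrite addnC Z2_coh_le Z2_mod.
Qed.

HB.instance Definition _ := GRing.ComUnitRing_isIntegral.Build Z2 Z2_idomain.

Definition Q2 : fieldType := {fraction Z2}.


Section RingOfIntegers.
Variable K : fieldExtType Q2.

(* The integral closure of Z_2 in K. *)
Definition integers : {pred K} :=
  fun x => `[< integralOver (in_alg K \o @tofrac Z2) x >].

Lemma integers_subring : subring_closed integers.
Proof.
split; first exact/asboolP/integral1.
- by move=> x y /asboolP Ox /asboolP Oy; apply/asboolP/integral_sub.
- by move=> x y /asboolP Ox /asboolP Oy; apply/asboolP/integral_mul.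
Qed.

HB.instance Definition _ :=
  GRing.isSubringClosed.Build K integers integers_subring.

(* The non-units of the ring of integers, which is local. *)
Definition maximal_ideal : set K :=
  [set x | x \in integers /\ ~ exists2 y, y \in integers & x * y = 1].

Definition mpow (n : nat) : set K :=
  [set 2 ^+ n * y | y in [set` integers]].

(* Ramification index 1: the uniformizer 2 of Q2 generates the maximal ideal.
   The residue extension is separable, as the residue field of Q2 is perfect. *)
Definition unramified : Prop := maximal_ideal = mpow 1.

End RingOfIntegers.

Arguments integers K : clear implicits.
Arguments maximal_ideal K : clear implicits.
Arguments mpow K n : clear implicits.

(* V with the translation-invariant topology in which the subgroups 2 ^ n L
   form a basis of neighbourhoods of 0. *)
Definition adic_space (V : zmodType) (L : {pred V}) : Type := V.

Section AdicTopology.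
Variables (V : zmodType) (L : zmodClosed V).

HB.instance Definition _ := Choice.on (adic_space L).

Definition adic_open : set_system (adic_space L) :=
  [set U | forall u : V, U u ->
    exists n, forall l : V, l \in L -> U (u + l *+ 2 ^ n)].

Lemma adic_openT : adic_open setT.
Proof. by move=> u _; exists 0%N. Qed.

Lemma adic_openI : setI_closed adic_open.
Proof.
move=> A B oA oB u [/oA[n An] /oB[k Bk]]; exists (n + k)%N => l Ll; split.
  by rewrite addnC expnD mulrnA; apply: An; apply: rpredMn.
by rewrite expnD mulrnA; apply: Bk; apply: rpredMn.
Qed.

Lemma adic_open_bigU (I : Type) (f : I -> set (adic_space L)) :
  (forall i, adic_open (f i)) -> adic_open (\bigcup_i f i).
Proof.
move=> of_ u [i _ /of_[n fn]]; exists n => l Ll.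
by exists i => //; apply: fn.
Qed.

HB.instance Definition _ := isOpenTopological.Build (adic_space L)
  adic_openT adic_openI adic_open_bigU.

End AdicTopology.

Section Span.
Variables (K : fieldExtType Q2) (V : lmodType K) (I : finType) (b : I -> V).

Definition Ospan : {pred V} :=
  fun v => `[< exists2 a : I -> K,
                 (forall i, a i \in integers K) & v = \sum_i a i *: b i >].

Lemma Ospan_zmod : zmod_closed Ospan.
Proof.
split.
  apply/asboolP; exists (fun=> 0) => [i|]; first exact: rpred0.
  by rewrite big1 // => i _; rewrite scale0r.
move=> _ _ /asboolP[a Oa ->] /asboolP[c Oc ->]; apply/asboolP.
exists (fun i => a i - c i) => [i|].
  by apply: rpredB; [apply: Oa|apply: Oc].
by rewrite -sumrB; apply: eq_bigr => i _; rewrite scalerBl.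
Qed.

HB.instance Definition _ := GRing.isZmodClosed.Build V Ospan Ospan_zmod.

Lemma OspanZ (a : K) v : a \in integers K -> v \in Ospan -> a *: v \in Ospan.
Proof.
move=> Oa /asboolP[c Oc ->]; apply/asboolP; exists (fun i => a * c i) => [i|].
  by apply: rpredM => //; apply: Oc.
by rewrite scaler_sumr; apply: eq_bigr => i _; rewrite scalerA.
Qed.

End Span.

Record symplectic_space (K : fieldType) (m : nat) := SymplecticSpace {
  sp_space :> vectType K;
  sp_form : {biscalar sp_space};
  sp_e : 'I_m -> sp_space;
  sp_es : 'I_m -> sp_space;
  sp_form_alt : forall w, sp_form w w = 0;
  sp_basis : basis_of fullv (codom sp_e ++ codom sp_es);
  sp_form_e : forall i j, sp_form (sp_e i) (sp_e j) = 0;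
  sp_form_es : forall i j, sp_form (sp_es i) (sp_es j) = 0;
  sp_form_ees : forall i j, sp_form (sp_e i) (sp_es j) = (i == j)%:R
}.

Section Heisenberg.
Variables (K : fieldExtType Q2) (m : nat) (W : symplectic_space K m).

Definition spX : {vspace W} := <<codom (@sp_e _ _ W)>>%VS.
Definition spXs : {vspace W} := <<codom (@sp_es _ _ W)>>%VS.

(* B (x + x* ) (y + y* ) = <x, y*> *)
Definition B (w w' : W) : K :=
  sp_form W (daddv_pi spX spXs w) (daddv_pi spXs spX w').
Definition B' (w w' : W) : K := 2 * B w w'.

Definition Heis : Type := (W * K)%type.
HB.instance Definition _ := Choice.on Heis.

(* The law written additively in H_B'(W) is the multiplication of the group. *)
Definition heis_mul (h h' : Heis) : Heis :=
  (h.1 + h'.1, h.2 + h'.2 + B' h.1 h'.1).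
Definition heis_one : Heis := (0, 0).
Definition heis_inv (h : Heis) : Heis := (- h.1, - h.2 + B' h.1 h.1).

Lemma B'Dl u v w : B' (u + v) w = B' u w + B' v w.
Proof. by rewrite /B' /B !linearD /= linearDl /= mulrDr. Qed.
Lemma B'Dr u v w : B' w (u + v) = B' w u + B' w v.
Proof. by rewrite /B' /B !linearD /= mulrDr. Qed.
Lemma B'0l w : B' 0 w = 0.
Proof. by rewrite /B' /B !linear0 linear0l mulr0. Qed.
Lemma B'0r w : B' w 0 = 0.
Proof. by rewrite /B' /B !linear0 mulr0. Qed.
Lemma B'Nl v w : B' (- v) w = - B' v w.
Proof. by apply/eqP; rewrite -addr_eq0 -B'Dl addNr B'0l. Qed.
Lemma B'Nr v w : B' w (- v) = - B' w v.
Proof. by apply/eqP; rewrite -addr_eq0 -B'Dr addNr B'0r. Qed.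

Lemma heis_mulA : associative heis_mul.
Proof.
move=> x y z; congr pair => /=; first by rewrite addrA.
by rewrite B'Dl B'Dr; ring.
Qed.
Lemma heis_mul1 : left_id heis_one heis_mul.
Proof. by case=> w t; rewrite /heis_mul /= B'0l !add0r addr0. Qed.
Lemma heis_mulg1 : right_id heis_one heis_mul.
Proof. by case=> w t; rewrite /heis_mul /= B'0r !addr0. Qed.
Lemma heis_mulV : left_inverse heis_one heis_inv heis_mul.
Proof.
by move=> [w t]; rewrite /heis_mul /= B'Nl addNr; congr pair; ring.
Qed.
Lemma heis_mulgV : right_inverse heis_one heis_inv heis_mul.
Proof.
by move=> [w t]; rewrite /heis_mul /= B'Nr subrr; congr pair; ring.
Qed.

HB.instance Definition _ := isGroup.Build Heis
  heis_mulA heis_mul1 heis_mulg1 heis_mulV heis_mulgV.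

Definition sp_b (i : 'I_m + 'I_m) : W :=
  match i with inl i => sp_e W i | inr i => sp_es W i end.

Definition WO : {pred W} := Ospan sp_b.
HB.instance Definition _ := GRing.ZmodClosed.on WO.

Definition Wm : {pred W} := fun w => `[< exists2 u, u \in WO & w = 2 *: u >].

Definition L' : {pred W} :=
  Ospan (fun i : 'I_m + 'I_m =>
           match i with inl i => 2 *: sp_e W i | inr i => sp_es W i end).

Definition heisO : {pred Heis} :=
  fun h => (h.1 \in WO) && (h.2 \in integers K).

Lemma sp_direct : (spX :&: spXs = 0)%VS.
Proof.
have /basis_free := sp_basis W; rewrite cat_free => /and3P[_ _].
by rewrite directvE /= => /directv_addP.
Qed.



End Heisenberg.

Arguments WO {K m} W.
Arguments Wm {K m} W.
Arguments L' {K m} W.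
Arguments heisO {K m} W.

Section HeisenbergIntegral.
Variables (K : fieldExtType Q2) (m : nat) (W : symplectic_space K m).
Local Notation spX := (spX W).
Local Notation spXs := (spXs W).
Local Notation WO := (WO W).

Lemma daddv_pi_out (U V : {vspace W}) v :
  (U :&: V = 0)%VS -> v \in V -> daddv_pi U V v = 0.
Proof.
move=> UV0 Vv; have Uv : v \in (U + V)%VS by exact: (subvP (addvSr _ _)).
have := daddv_pi_add UV0 Uv; rewrite (daddv_pi_id _ Vv) 1?capvC //.
by move/(congr1 (+%R^~ (- v))); rewrite addrK subrr.
Qed.

Lemma sp_direct' : (spXs :&: spX = 0)%VS.
Proof. by rewrite capvC sp_direct. Qed.

Lemma B'_sp_b i j : B' (sp_b W i) (sp_b W j) \in integers K.
Proof.
rewrite /B' rpredM ?rpred_nat // /B.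
have eX k : sp_e W k \in spX by rewrite memv_span // codom_f.
have esX k : sp_es W k \in spXs by rewrite memv_span // codom_f.
case: i => i; case: j => j /=.
- by rewrite (daddv_pi_out sp_direct' (eX j)) linear0 rpred0.
- rewrite (daddv_pi_id (sp_direct W)) // (daddv_pi_id sp_direct') //.
  by rewrite sp_form_ees rpred_nat.
- by rewrite (daddv_pi_out sp_direct' (eX j)) linear0 rpred0.
- by rewrite (daddv_pi_out (sp_direct W) (esX i)) linear0l rpred0.
Qed.

Lemma B'Zl a (v w : W) : B' (a *: v) w = a * B' v w.
Proof. by rewrite /B' /B linearZ /= linearZl_LR /= mulrCA. Qed.
Lemma B'Zr a (v w : W) : B' v (a *: w) = a * B' v w.
Proof. by rewrite /B' /B linearZ /= linearZr_LR /= mulrCA. Qed.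

Lemma B'_WO w w' : w \in WO -> w' \in WO -> B' w w' \in integers K.
Proof.
move=> /asboolP[a Oa ->] /asboolP[c Oc ->].
rewrite (big_morph (fun u => B' u _) (fun u v => B'Dl u v _) (B'0l _)).
apply: rpred_sum => i _; rewrite B'Zl; apply: rpredM; first exact: Oa.
rewrite (big_morph (fun u => B' _ u) (fun u v => B'Dr u v _) (B'0r _)).
apply: rpred_sum => j _; rewrite B'Zr; apply: rpredM; first exact: Oc.
exact: B'_sp_b.
Qed.

Lemma heisO_group : group_closed (heisO W).
Proof.
split; first by apply/andP; split; exact: rpred0.
move=> x y /andP[x1 x2] /andP[y1 y2]; apply/andP; split=> /=.
  exact: rpredB.
by rewrite !rpredD ?rpredN //; apply: B'_WO; rewrite ?rpredN.
Qed.

Record HeisO := MkHeisO { heisO_val :> Heis W; _ : heisO_val \in heisO W }.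
HB.instance Definition _ := [isSub for heisO_val].
HB.instance Definition _ := [Choice of HeisO by <:].
HB.instance Definition _ :=
  SubChoice_isSubGroup.Build (Heis W) (heisO W) HeisO heisO_group.

End HeisenbergIntegral.

Record raction (P H : groupType) := RightAction {
  ract :> H -> P -> H;
  ract1 : forall h, ract h 1%g = h;
  ractM : forall h p p', ract h (p * p')%g = ract (ract h p) p';
  ract_mul : forall h h' p, ract (h * h')%g p = (ract h p * ract h' p)%g
}.

(* The pair (p, h) stands for the product p h, and h p = p (h . p). *)
Definition semidirect (P H : groupType) (a : raction P H) : Type := (P * H)%type.

Section Semidirect.
Variables (P H : groupType) (a : raction P H).
Local Open Scope group_scope.
HB.instance Definition _ := Choice.on (semidirect a).

Definition sd_mul (x y : semidirect a) : semidirect a :=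
  (x.1 * y.1, a x.2 y.1 * y.2).
Definition sd_one : semidirect a := (1, 1).
Definition sd_inv (x : semidirect a) : semidirect a :=
  (x.1^-1, (a x.2 x.1^-1)^-1).

Lemma ract_one p : a 1 p = 1.
Proof. by apply: (@mulgI _ (a 1 p)); rewrite -ract_mul !mulg1. Qed.

Lemma sd_mulA : associative sd_mul.
Proof.
by move=> x y z; congr pair => /=; rewrite ?ract_mul -?ractM ?mulgA.
Qed.
Lemma sd_mul1 : left_id sd_one sd_mul.
Proof. by case=> p h; rewrite /sd_mul /= ract_one !mul1g. Qed.
Lemma sd_mulg1 : right_id sd_one sd_mul.
Proof. by case=> p h; rewrite /sd_mul /= ract1 !mulg1. Qed.
Lemma ractV h p : a h^-1 p = (a h p)^-1.
Proof. by apply: (@mulgI _ (a h p)); rewrite -ract_mul !mulgV ract_one. Qed.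
Lemma sd_mulV : left_inverse sd_one sd_inv sd_mul.
Proof.
by case=> p h; rewrite /sd_mul /= ractV -ractM mulVg ract1 mulVg.
Qed.
Lemma sd_mulgV : right_inverse sd_one sd_inv sd_mul.
Proof. by case=> p h; rewrite /sd_mul /= !mulgV. Qed.

HB.instance Definition _ := isGroup.Build (semidirect a)
  sd_mulA sd_mul1 sd_mulg1 sd_mulV sd_mulgV.

Definition sd_inr (h : H) : semidirect a := (1, h).

End Semidirect.

Lemma adic_nbhsP (V : zmodType) (L : zmodClosed V) (u : adic_space L) (A : set (adic_space L)) :
  nbhs u A <-> exists n, forall l : V, l \in L -> A ((u : V) + l *+ 2 ^ n).
Proof.
split=> [[U [oU Uu UA]]|[n An]].
  by have [n Un] := oU _ Uu; exists n => l /Un /UA.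
exists [set (u : V) + l *+ 2 ^ n | l in [set` L]]; split.
- move=> _ [l Ll <-]; exists n => l' Ll'; exists (l + l').
    exact: rpredD.
  by rewrite mulrnDl addrA.
- by exists 0; [exact: rpred0|rewrite mul0rn addr0].
- by move=> _ [l Ll <-]; exact: An.
Qed.

Section AdicContinuity.
Variables (V V' : zmodType) (L : zmodClosed V) (L' : zmodClosed V').

Lemma adic_continuousP (f : adic_space L -> adic_space L') :
  continuous f <-> forall (w : V) n, exists k, forall l : V, l \in L ->
    exists2 l' : V', l' \in L' & f (w + l *+ 2 ^ k) = (f w : V') + l' *+ 2 ^ n.
Proof.
split=> [cf w n|cf w A Aw].
  pose A : set (adic_space L') := [set (f w : V') + l *+ 2 ^ n | l in [set` L']].
  have nA : nbhs (f w) A by apply/adic_nbhsP; exists n => l Ll; exists l.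
  have /adic_nbhsP[k hk] : nbhs (w : adic_space L) (f @^-1` A) by exact: cf.
  by exists k => l /hk [l' Ll' <-]; exists l'.
have /adic_nbhsP[n An] : nbhs (f w) A by [].
apply/adic_nbhsP; have [k hk] := cf w n; exists k => l Ll /=.
by have [l' Ll' ->] := hk l Ll; exact: An.
Qed.

End AdicContinuity.

Section Mpow.
Variable K : fieldExtType Q2.
Lemma mpow_zmod n : zmod_closed [pred x | `[< mpow K n x >]].
Proof.
split; first by apply/asboolP; exists 0; rewrite ?mulr0 //; exact: rpred0.
move=> _ _ /asboolP[x Ox <-] /asboolP[y Oy <-]; apply/asboolP.
by exists (x - y); rewrite ?mulrBr //; exact: rpredB.
Qed.
Lemma mpow0 n : mpow K n 0.
Proof. by case: (mpow_zmod n) => /asboolP. Qed.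
Lemma mpowB n x y : mpow K n x -> mpow K n y -> mpow K n (x - y).
Proof. by move=> hx hy; apply/asboolP/(mpow_zmod n).2; apply/asboolP. Qed.
Lemma mpowN n x : mpow K n x -> mpow K n (- x).
Proof. by rewrite -[- x]sub0r; apply: mpowB; exact: mpow0. Qed.
Lemma mpowD n x y : mpow K n x -> mpow K n y -> mpow K n (x + y).
Proof. by move=> hx hy; rewrite -[y]opprK; apply/mpowB/mpowN. Qed.
End Mpow.

Section Pseudosymplectic.
Variables (K : fieldExtType Q2) (m : nat) (W : symplectic_space K m).
Local Notation O := (integers K).
Local Notation WO := (WO W).
Local Notation Wm := (Wm W).

(* Groups act on the right: w g is [g w], and the product g g' is the
   composite g' \o g. *)
Definition is_Sp (g : 'End(W)) : Prop :=
  lker g = 0%VS /\ forall w w', sp_form W (g w) (g w') = sp_form W w w'.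

Definition is_Ps (x : 'End(W) * (W -> K)) : Prop :=
  [/\ is_Sp x.1, continuous (x.2 : adic_space WO -> adic_space O) &
      forall w w', x.2 (w + w') - x.2 w - x.2 w' =
                   B' (x.1 w) (x.1 w') - B' w w'].

Definition polar (q : W -> K) (u v : W) : K := q (u + v) - q u - q v.

(* q, defined on W, induces a quadratic function WO / Wm -> O / m^2.  All
   conditions are congruences modulo m^2 between values of q; the first one says
   that q descends to WO / Wm. *)
Definition quadratic (q : W -> K) : Prop :=
  [/\ forall w u, w \in WO -> u \in Wm -> mpow K 2 (q (w + u) - q w),
      forall a w, a \in O -> w \in WO -> mpow K 2 (q (a *: w) - a ^+ 2 * q w),
      forall u v w, u \in WO -> v \in WO -> w \in WO ->
        mpow K 2 (polar q (u + v) w - (polar q u w + polar q v w)) &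
      forall u v w, u \in WO -> v \in WO -> w \in WO ->
        mpow K 2 (polar q w (u + v) - (polar q w u + polar q w v))].

Definition is_PsO (x : 'End(W) * (W -> K)) : Prop :=
  [/\ is_Ps x,
      x.1 @` [set` WO] = [set` WO],
      forall w, w \in WO -> x.2 w \in O,
      forall w, w \in Wm -> mpow K 2 (x.2 w) &
      quadratic x.2].

Record PsO := MkPsO {
  PsO_val :> 'End(W) * (W -> K); _ : `[< is_PsO PsO_val >] }.
HB.instance Definition _ := [isSub for PsO_val].
HB.instance Definition _ := [Choice of PsO by <:].

Lemma PsOP (x : PsO) : is_PsO x.
Proof. exact: asboolP (valP x). Qed.

Definition Ps_mul (x y : 'End(W) * (W -> K)) : 'End(W) * (W -> K) :=
  ((y.1 \o x.1)%VF, fun w => x.2 w + y.2 (x.1 w)).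
Definition Ps_one : 'End(W) * (W -> K) := (\1%VF, fun=> 0).
Definition Ps_inv (x : 'End(W) * (W -> K)) : 'End(W) * (W -> K) :=
  (x.1^-1%VF, fun w => - x.2 (x.1^-1%VF w)).

Section Closure.

Lemma WO_stab (g : 'End(W)) w :
  g @` [set` WO] = [set` WO] -> w \in WO -> g w \in WO.
Proof. by move=> gWO Ww; suff : [set` WO] (g w) by []; rewrite -gWO; exists w. Qed.

Lemma Wm_stab (g : 'End(W)) w :
  g @` [set` WO] = [set` WO] -> w \in Wm -> g w \in Wm.
Proof.
move=> gWO /asboolP[u Wu ->]; apply/asboolP; exists (g u); rewrite ?linearZ//.
exact: WO_stab.
Qed.

Lemma WO_stabV (g : 'End(W)) : lker g = 0%VS ->
  g @` [set` WO] = [set` WO] -> (g^-1)%VF @` [set` WO] = [set` WO].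
Proof.
move=> /eqP kg gWO; apply/seteqP; split=> [_ [w Ww <-]|w Ww].
  have : [set` WO] w by []. rewrite -{1}gWO => -[u Wu <-].
  by rewrite lker0_lfunK.
by exists (g w); rewrite ?lker0_lfunK //; exact: WO_stab.
Qed.

Lemma quadraticD q r : quadratic q -> quadratic r ->
  quadratic (fun w => q w + r w).
Proof.
move=> [q1 q2 q3 q4] [r1 r2 r3 r4]; split=> [w u|a w|u v w|u v w] *.
- by rewrite opprD addrACA; apply: mpowD; [apply: q1|apply: r1].
- by rewrite mulrDr opprD addrACA; apply: mpowD; [apply: q2|apply: r2].
- have -> : polar (fun w => q w + r w) (u + v) w -
      (polar (fun w => q w + r w) u w + polar (fun w => q w + r w) v w) =
    (polar q (u + v) w - (polar q u w + polar q v w)) +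
    (polar r (u + v) w - (polar r u w + polar r v w)).
    by rewrite /polar; ring.
  by apply: mpowD; [apply: q3|apply: r3].
- have -> : polar (fun w => q w + r w) w (u + v) -
      (polar (fun w => q w + r w) w u + polar (fun w => q w + r w) w v) =
    (polar q w (u + v) - (polar q w u + polar q w v)) +
    (polar r w (u + v) - (polar r w u + polar r w v)).
    by rewrite /polar; ring.
  by apply: mpowD; [apply: q4|apply: r4].
Qed.

Lemma quadraticN q : quadratic q -> quadratic (fun w => - q w).
Proof.
move=> [q1 q2 q3 q4]; split=> [w u|a w|u v w|u v w] *.
- by rewrite -opprD; apply/mpowN/q1.
- by rewrite mulrN -opprD; apply/mpowN/q2.
- have -> : polar (fun w => - q w) (u + v) w -
      (polar (fun w => - q w) u w + polar (fun w => - q w) v w) =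
    - (polar q (u + v) w - (polar q u w + polar q v w)).
    by rewrite /polar; ring.
  by apply/mpowN/q3.
- have -> : polar (fun w => - q w) w (u + v) -
      (polar (fun w => - q w) w u + polar (fun w => - q w) w v) =
    - (polar q w (u + v) - (polar q w u + polar q w v)).
    by rewrite /polar; ring.
  by apply/mpowN/q4.
Qed.

Lemma quadratic_comp q (g : 'End(W)) : g @` [set` WO] = [set` WO] ->
  quadratic q -> quadratic (fun w => q (g w)).
Proof.
move=> gWO [q1 q2 q3 q4].
split=> [w u Ww Wu|a w Oa Ww|u v w Wu Wv Ww|u v w Wu Wv Ww].
- by rewrite linearD; apply: q1; [apply: WO_stab|apply: Wm_stab].
- by rewrite linearZ; apply: q2 => //; apply: WO_stab.
- have := q3 (g u) (g v) (g w).
  rewrite /polar -!linearD; apply; exact: WO_stab.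
- have := q4 (g u) (g v) (g w).
  rewrite /polar -!linearD; apply; exact: WO_stab.
Qed.

Lemma quadratic0 : quadratic (fun=> 0).
Proof.
split=> *; rewrite /polar ?mulr0 ?subr0 ?addr0 ?subrr; exact: mpow0.
Qed.

Lemma adic_contD (q r : W -> K) :
  continuous (q : adic_space WO -> adic_space O) ->
  continuous (r : adic_space WO -> adic_space O) ->
  continuous ((fun w => q w + r w) : adic_space WO -> adic_space O).
Proof.
move=> /adic_continuousP cq /adic_continuousP cr; apply/adic_continuousP => w n.
have [i hi] := cq w n; have [j hj] := cr w n; exists (i + j)%N => l Ll.
have [l1 O1 e1] := hi _ (rpredMn (2 ^ j) Ll).
have [l2 O2 e2] := hj _ (rpredMn (2 ^ i) Ll).
exists (l1 + l2); first exact: rpredD.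
rewrite -!mulrnA -!expnD [(j + i)%N]addnC in e1 e2.
by rewrite e2 e1 mulrnDl addrACA.
Qed.

Lemma adic_contN (q : W -> K) :
  continuous (q : adic_space WO -> adic_space O) ->
  continuous ((fun w => - q w) : adic_space WO -> adic_space O).
Proof.
move=> /adic_continuousP cq; apply/adic_continuousP => w n.
have [i hi] := cq w n; exists i => l /hi[l1 O1 ->].
by exists (- l1); rewrite ?rpredN // opprD mulNrn.
Qed.

Lemma adic_cont_comp (q : W -> K) (g : 'End(W)) :
  g @` [set` WO] = [set` WO] ->
  continuous (q : adic_space WO -> adic_space O) ->
  continuous ((fun w => q (g w)) : adic_space WO -> adic_space O).
Proof.
move=> gWO /adic_continuousP cq; apply/adic_continuousP => w n.
have [i hi] := cq (g w) n; exists i => l Ll.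
have [l1 O1 e1] := hi _ (WO_stab gWO Ll).
by exists l1; rewrite // linearD raddfMn; exact: e1.
Qed.

Lemma Ps_one_subproof : is_PsO Ps_one.
Proof.
split=> //=.
- split=> /=.
  + split=> [|w w']; last by rewrite !id_lfunE.
    by apply/eqP/lker0P => w w'; rewrite !id_lfunE.
  + apply/adic_continuousP => w n; exists 0%N => l _; exists 0.
      exact: rpred0.
    by rewrite mul0rn addr0.
  + by move=> w w'; rewrite !id_lfunE !subrr.
- by apply/seteqP; split=> [_ [w Ww <-]|w Ww]; [rewrite /= id_lfunE|
     exists w; rewrite ?id_lfunE].
- by move=> *; exact: rpred0.
- by move=> *; exact: mpow0.
- exact: quadratic0.
Qed.

Lemma Ps_mul_subproof x y : is_PsO x -> is_PsO y -> is_PsO (Ps_mul x y).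
Proof.
case: x y => [g q] [h r] [/= [[kg ig] cq eq] gWO qO qm qq].
move=> [/= [[kh ih] cr er] hWO rO rm rq]; split=> /=.
- split=> /=.
  + split=> [|w w']; last by rewrite !lfunE /= ih ig.
    move/eqP/lker0P: kg => kg; move/eqP/lker0P: kh => kh.
    by apply/eqP/lker0P => w w'; rewrite !lfunE /= => /kh/kg.
  + by apply: adic_contD => //; exact: adic_cont_comp.
  + move=> w w'; rewrite !lfunE /= linearD.
    transitivity ((q (w + w') - q w - q w') +
                  (r (g w + g w') - r (g w) - r (g w'))); first by ring.
    by rewrite eq er; ring.
- apply/seteqP; split=> [_ [w Ww <-]|w].
    by rewrite /= lfunE /=; do 2!apply: WO_stab => //.
  rewrite -{1}hWO => -[u]; rewrite -{1}gWO => -[v Wv <-] <-.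
  by exists v; rewrite ?lfunE.
- by move=> w Ww; rewrite rpredD ?qO // rO // WO_stab.
- by move=> w Ww; apply: mpowD; [exact: qm|apply/rm/Wm_stab].
- by apply: quadraticD => //; exact: quadratic_comp.
Qed.

Lemma Ps_inv_subproof x : is_PsO x -> is_PsO (Ps_inv x).
Proof.
case: x => [g q] [/= [[kg ig] cq eq] gWO qO qm qq].
have iWO := WO_stabV kg gWO.
have gK : cancel (g^-1)%VF g by apply/lker0_lfunVK/eqP.
split=> //=.
- split=> /=.
  + split=> [|w w']; last by rewrite -ig !gK.
    by apply/eqP/lker0P; exact: can_inj gK.
  + by apply: adic_contN; exact: adic_cont_comp.
  + move=> w w'; have := eq ((g^-1)%VF w) ((g^-1)%VF w').
    rewrite !gK -linearD /= => e.
    by rewrite -[RHS]opprB -e; ring.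
- by move=> w Ww; rewrite rpredN qO // WO_stab.
- by move=> w Ww; apply/mpowN/qm/Wm_stab.
- by apply: quadraticN; exact: quadratic_comp.
Qed.

End Closure.

Definition PsO_mul (x y : PsO) : PsO :=
  MkPsO (asboolT (Ps_mul_subproof (PsOP x) (PsOP y))).
Definition PsO_one : PsO := MkPsO (asboolT Ps_one_subproof).
Definition PsO_inv (x : PsO) : PsO := MkPsO (asboolT (Ps_inv_subproof (PsOP x))).

Lemma PsO_mulA : associative PsO_mul.
Proof.
move=> x y z; apply/val_inj; rewrite /= /Ps_mul /= comp_lfunA; congr pair.
by apply/funext => w; rewrite lfunE /= addrA.
Qed.
Lemma PsO_mul1 : left_id PsO_one PsO_mul.
Proof.
move=> x; apply/val_inj; case: x => -[g q] gq; rewrite /= /Ps_mul /=.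
by rewrite comp_lfun1r; congr pair; apply/funext => w; rewrite id_lfunE add0r.
Qed.
Lemma PsO_mulg1 : right_id PsO_one PsO_mul.
Proof.
move=> x; apply/val_inj; case: x => -[g q] gq; rewrite /= /Ps_mul /=.
by rewrite comp_lfun1l; congr pair; apply/funext => w; rewrite addr0.
Qed.
Lemma PsO_mulV : left_inverse PsO_one PsO_inv PsO_mul.
Proof.
move=> x; apply/val_inj; have [[[/eqP kg _] _ _] _ _ _ _] := PsOP x.
case: x kg => -[g q] gq /= kg; rewrite /Ps_mul /Ps_inv /Ps_one /=.
by rewrite lker0_compfV //; congr pair; apply/funext => w; rewrite addNr.
Qed.
Lemma PsO_mulgV : right_inverse PsO_one PsO_inv PsO_mul.
Proof.
move=> x; apply/val_inj; have [[[/eqP kg _] _ _] _ _ _ _] := PsOP x.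
case: x kg => -[g q] gq /= kg; rewrite /Ps_mul /Ps_inv /Ps_one /=.
rewrite lker0_compVf //; congr pair; apply/funext => w.
by rewrite lker0_lfunK // subrr.
Qed.

HB.instance Definition _ := isGroup.Build PsO
  PsO_mulA PsO_mul1 PsO_mulg1 PsO_mulV PsO_mulgV.

Definition Ps_act (h : Heis W) (x : 'End(W) * (W -> K)) : Heis W :=
  (x.1 h.1, h.2 + x.2 h.1).

Lemma Ps_act_subproof (h : HeisO W) (x : PsO) : Ps_act h x \in heisO W.
Proof.
have [_ gWO qO _ _] := PsOP x; have /andP[h1 h2] := valP h.
by apply/andP; split=> /=; [exact: WO_stab|rewrite rpredD // qO].
Qed.

Definition PsO_act (h : HeisO W) (x : PsO) : HeisO W :=
  MkHeisO (Ps_act_subproof h x).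

Lemma PsO_act1 h : PsO_act h 1%g = h.
Proof.
by apply/val_inj; case: h => -[w t] hh; rewrite /= /Ps_act /= id_lfunE addr0.
Qed.
Lemma PsO_actM h x y : PsO_act h (x * y)%g = PsO_act (PsO_act h x) y.
Proof. by apply/val_inj; rewrite /= /Ps_act /= lfunE /= addrA. Qed.
Lemma PsO_act_mul (h h' : HeisO W) (x : PsO) :
  PsO_act (h * h')%g x = (PsO_act h x * PsO_act h' x)%g.
Proof.
have [[_ _ e] _ _ _ _] := PsOP x.
apply/val_inj; rewrite /= /Ps_act; congr pair => /=; first by rewrite linearD.
move: (e (val h).1 (val h').1) => /(canRL (subrK _))/(canRL (subrK _)) ->.
by ring.
Qed.

Definition PsO_raction : raction PsO (HeisO W) :=
  RightAction PsO_act1 PsO_actM PsO_act_mul.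

End Pseudosymplectic.

Section Representation.
Variables (R : realType) (K : fieldExtType Q2) (m : nat).
Variable W : symplectic_space K m.
Local Notation C := R[i].
Local Notation O := (integers K).
Local Notation WO := (WO W).
Variable Psi : K -> C.

Definition is_character : Prop :=
  [/\ forall x y, Psi (x + y) = Psi x * Psi y,
      forall x, `|Psi x| = 1 &
      continuous (Psi : adic_space O -> C^o)].

Definition level_m2 : Prop :=
  (forall x, mpow K 2 x -> Psi x = 1) /\ (exists2 x, mpow K 1 x & Psi x != 1).

Definition locally_constant (f : W -> C^o) : Prop :=
  forall w : adic_space WO, \forall w' \near w, f w' = f w.

Definition compactly_supported (f : W -> C^o) : Prop :=
  compact (closure [set w : adic_space WO | f w != 0]).

Definition S_L' (f : W -> C^o) : Prop :=
  [/\ locally_constant f, compactly_supported f &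
      forall l w, l \in L' W -> f (l + w) = Psi (- B' l w) * f w].

Definition V_psi : {pred W -> C^o} :=
  fun f => `[< S_L' f /\ forall w, w \notin WO -> f w = 0 >].

Lemma V_psi_submod : submod_closed V_psi.
Proof.
split.
  apply/asboolP; split=> //; split.
  - by move=> w; apply: (@filterE _ (nbhs w)).
  - rewrite /compactly_supported; set S := (X in closure X).
    suff -> : S = set0 by rewrite closure0; exact: compact0.
    by apply/seteqP; split=> // w; rewrite /S /= eqxx.
  - by move=> *; rewrite mulr0.
move=> a f g /asboolP[[fl fc fe] fs] /asboolP[[gl gc ge] gs].
apply/asboolP; split; first split.
- move=> w; have := fl w; have := gl w; apply: filterS2 => w' gw fw.
  by rewrite /= !fctE gw fw.
- apply: (subclosed_compact _ (compactU fc gc)); first exact: closed_closure.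
  rewrite -closureU; apply: closure_subset => w /=.
  apply: contraPP => /not_orP[/negP/negPn/eqP f0 /negP/negPn/eqP g0].
  by apply/negP/negPn; rewrite !fctE f0 g0 scaler0 addr0.
- move=> l w Ll; rewrite !fctE fe // ge //.
  by rewrite mulrDr scalerAr.
- by move=> w Ww; rewrite !fctE fs // gs // scaler0 addr0.
Qed.

HB.instance Definition _ :=
  GRing.isSubmodClosed.Build C (W -> C^o) V_psi V_psi_submod.

Record Vpsi := MkVpsi { Vpsi_val :> W -> C^o; _ : Vpsi_val \in V_psi }.
HB.instance Definition _ := [isSub for Vpsi_val].
HB.instance Definition _ := [Choice of Vpsi by <:].
HB.instance Definition _ := [SubChoice_isSubLmodule of Vpsi by <:].

Definition Pi' (h : Heis W) (f : W -> C^o) : W -> C^o :=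
  fun w => Psi (h.2 + B' w h.1) * f (w + h.1).

End Representation.

Definition projective_representation (G : groupType) (F : fieldType)
    (V : lmodType F) (rho : G -> {linear V -> V}) : Prop :=
  (forall g, bijective (rho g)) /\
  (forall g h, exists2 c : F, c != 0 &
     forall v, rho (g * h)%g v = c *: rho g (rho h v)).

(* Main.v *)
Require Import Defs.
From HB Require Import structures.
From mathcomp Require Import all_boot all_order all_algebra all_field.
From mathcomp Require Import all_classical all_reals topology normedtype.
From mathcomp Require Import complex ring.
Set Implicit Arguments.
Unset Strict Implicit.
Unset Printing Implicit Defensive.
Import Order.TTheory GRing.Theory Num.Theory numFieldNormedType.Exports.
Local Open Scope classical_set_scope.
Local Open Scope ring_scope.

(** V_psi is the Schroedinger model of a finite Heisenberg group, and the
    statement is the theorem of Stone and von Neumann for it: an element p of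
    P's(W_O) acts on H_B'(W_O) and fixes its centre, hence Pi' and its twist by p
    are irreducible representations with the same central character, and there is
    an operator T p between them, unique up to a scalar.  Since T (p p') and
    T p o T p' intertwine the same pair of representations, the operators
    T p o Pi' h form a projective representation of the semidirect product
    ([projective_extension]).

    The arguments only use translates and averages.  For l in L' and w in W_O the
    number B' l w lies in m^2, where Psi is 1; so V_psi consists of the
    L'-invariant functions supported on W_O, and the operators Pi' (l, 0) with l
    in L' multiply by the characters Psi (B' _ l) of W_O / L'.  These separate the
    points of W_O / L', because K is unramified and Psi is not trivial on m
    ([B'_dual_L']).  Hence the average of Pi' (l, 0) over L' is a multiple of the
    rank one operator f |-> f 0 *: vacuum, where vacuum is the indicator function
    of L' ([vacuum_projectionE]).  Two consequences are immediate: the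
    representation is irreducible, because every element of V_psi is a sum of
    translates of vacuum, and an operator that commutes with Pi' is a scalar.

    For the existence of T p, let sigma be the twist of Pi' by p and Q the average
    of the sigma (l, 0) over L'.  By Frobenius reciprocity, for any point x0 the
    function T f : z |-> (Q (sigma (z, 0) f)) x0 is L'-invariant and
    T o sigma h = Pi' h o T.  For some x0 it is not zero, because Q is not: the
    conjugates of Q by the sigma (x, 0) sum to a non-zero multiple of the identity
    ([twisted_coefficient_neq0]).  An intertwining operator that is not zero
    between irreducible representations is bijective.

    All averages need W_O / 2 W_O to be finite and V_psi to contain every
    L'-invariant function on W_O, that is, W_O to be compact.  Compactness is
    deduced from the definition of V_psi: a non-zero f in V_psi has a support with
    compact closure, which contains a coset of 2 W_O.  If there is no such f, then
    V_psi = 0 and the identity operators will do. *)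

(** * Sums over representatives of the cosets of a subgroup *)

Section CosetRepresentatives.
Variables (V : zmodType) (L : zmodClosed V).

(** A sequence of representatives makes it possible to sum over D / L although
    the quotient has no type of its own. *)
Definition coset_reps (D : {pred V}) (s : seq V) : Prop :=
  [/\ uniq s, {subset s <= D},
      forall w, w \in D -> exists2 x, x \in s & w - x \in L &
      forall x y, x \in s -> y \in s -> x - y \in L -> x = y].

Lemma coset_reps_filter (D E : zmodClosed V) s :
  {subset L <= E} -> {subset E <= D} -> coset_reps D s ->
  coset_reps E [seq x <- s | x \in E].
Proof.
move=> LE ED [us sD sc si]; split.
- exact: filter_uniq.
- by move=> x; rewrite mem_filter => /andP[].
- move=> w Ew; have [x sx Lx] := sc w (ED _ Ew); exists x => //.
  rewrite mem_filter sx andbT -[x](subKr w) rpredB //; exact: LE.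
- by move=> x y; rewrite !mem_filter => /andP[_ sx] /andP[_ sy]; apply: si.
Qed.

(** Translation by u permutes the cosets. *)
Lemma coset_reps_shift (M : nmodType) (D : zmodClosed V) s (F : V -> M) u :
    coset_reps D s -> u \in D ->
    (forall x l, x \in D -> l \in L -> F (x + l) = F x) ->
  \sum_(x <- s) F (x + u) = \sum_(x <- s) F x.
Proof.
move=> [us sD sc si] Du FL.
have /choice[r rP] : forall w, exists x, w \in D -> x \in s /\ w - x \in L.
  move=> w; have [/sc[x sx Lx]|_] := boolP (w \in D); first by exists x.
  by exists 0.
have rs x : x \in s -> r (x + u) \in s /\ (x + u) - r (x + u) \in L.
  by move=> /sD Dx; apply: rP; exact: rpredD.
have injr : {in s &, injective (fun x => r (x + u))}.
  move=> x y sx sy rxy; apply: (si _ _ sx sy).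
  have [_ Lx] := rs x sx; have [_ Ly] := rs y sy.
  have -> : x - y = (x + u - r (x + u)) - (y + u - r (y + u)).
    by rewrite rxy opprB addrA subrK opprD addrACA subrr addr0.
  exact: rpredB.
have ur : uniq [seq r (x + u) | x <- s] by rewrite map_inj_in_uniq.
have sub : {subset [seq r (x + u) | x <- s] <= s}.
  by move=> _ /mapP[x sx ->]; have [] := rs x sx.
have [_ eqs] := uniq_min_size ur sub ltac:(by rewrite size_map).
rewrite -[RHS](perm_big _ (uniq_perm ur us eqs)) big_map /=.
rewrite big_seq [RHS]big_seq; apply: eq_bigr => x sx.
have [/sD Dr Lx] := rs x sx.
by rewrite -(FL _ _ Dr Lx) [r _ + _]addrC subrK.
Qed.

Lemma coset_reps_size (F : numFieldType) (D : zmodClosed V) s :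
  coset_reps D s -> (size s)%:R != 0 :> F.
Proof.
move=> [_ _ sc _]; rewrite pnatr_eq0.
by have [x + _] := sc 0 (rpred0 _); case: s sc.
Qed.

(** A non-trivial character sums to zero, since translating the summation by
    an element where it is not 1 multiplies the sum by that value. *)
Lemma coset_reps_char_sum (F : fieldType) (D : zmodClosed V) s
    (chi : V -> F) u :
    coset_reps D s -> {subset L <= D} ->
    {in D &, forall x y, chi (x + y) = chi x * chi y} ->
    {in L, forall l, chi l = 1} -> u \in D -> chi u != 1 ->
  \sum_(x <- s) chi x = 0.
Proof.
move=> ts LD chiM chiL Du chiu.
have [us sD _ _] := ts.
have : \sum_(x <- s) chi (x + u) = \sum_(x <- s) chi x.
  apply: coset_reps_shift ts Du _ => x l Dx Ll.
  by rewrite (chiM _ _ Dx (LD _ Ll)) (chiL _ Ll) mulr1.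
rewrite (eq_big_seq (fun x => chi x * chi u)); last first.
  by move=> x /sD Dx; rewrite chiM.
rewrite -mulr_suml => /eqP; rewrite -subr_eq0 -[X in _ - X]mulr1 -mulrBr.
by rewrite mulf_eq0 subr_eq0 (negbTE chiu) orbF => /eqP.
Qed.

End CosetRepresentatives.

(** * Compactness in the adic topology *)

Section AdicCompactness.
Variables (V : zmodType) (L : zmodClosed V).

HB.instance Definition _ := isPointed.Build (adic_space L) 0.

Lemma adic_openP (A : set (adic_space L)) :
  (forall u, A u -> exists n, forall l : V, l \in L -> A ((u : V) + l *+ 2 ^ n)) ->
  open A.
Proof. by rewrite openE => hA u Au; apply/adic_nbhsP/hA. Qed.

(** A union of cosets of 2 ^ n L is closed, since its complement is one too. *)
Lemma adic_closed (A : set (adic_space L)) n :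
    (forall u l : V, l \in L -> A (u + l *+ 2 ^ n) -> A u) -> closed A.
Proof.
move=> hA; rewrite -openC; apply: adic_openP => u nAu.
exists n => l Ll; apply: contra_not nAu.
exact: hA.
Qed.

(** The cosets of a subgroup that contains 2 ^ n L are open, so that finitely many
    of them cover the compact set D. *)
Lemma compact_coset_reps (D : {pred V}) n :
    compact ([set` D] : set (adic_space L)) ->
  forall M : zmodClosed V, (forall l, l \in L -> l *+ 2 ^ n \in M) ->
  exists s, coset_reps M D s.
Proof.
move=> cD M LM; rewrite compact_cover in cD.
pose f (x : V) : set (adic_space L) := [set y : V | y - x \in M].
have [//| |E ED Ecov] := cD V [set` D] f.
- move=> x _; apply: adic_openP => u; rewrite /f /= => Mu; exists n => l Ll.
  by rewrite addrAC rpredD // LM.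
- by move=> w Dw; exists w => //; rewrite /f /= subrr rpred0.
(* a representative of each coset, depending on the coset only *)
pose c (w : V) : V := xget 0 [set x | x \in D /\ w - x \in M].
have cP w : w \in D -> c w \in D /\ w - c w \in M.
  by move=> Dw; apply: (xgetPex 0 (P := [set x | x \in D /\ w - x \in M]));
    exists w; split=> //; rewrite subrr rpred0.
have cE w w' : w - w' \in M -> c w = c w'.
  move=> Mww'; congr (xget _ _); apply/seteqP.
  split=> x [Dx Mx]; split=> //.
    by rewrite -(subrK w w') -addrA rpredD // -opprB rpredN.
  by rewrite -(subrK w' w) -addrA rpredD.
exists (undup [seq c x | x <- finmap.enum_fset E]); split.
- exact: undup_uniq.
- by move=> x; rewrite mem_undup => /mapP[y /ED /set_mem Dy ->]; have [] := cP y Dy.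
- move=> w Dw; have [y /= Ey My] := Ecov w Dw.
  exists (c y); first by rewrite mem_undup map_f.
  rewrite -(cE w y) //; have [] := cP w Dw => //.
- move=> x y; rewrite !mem_undup => /mapP[x' Ex' ->] /mapP[y' Ey' ->] Mxy.
  have [/(ED _)/set_mem Dx /(ED _)/set_mem Dy] := (Ex', Ey').
  apply: cE; have [[_ Mx] [_ My]] := (cP _ Dx, cP _ Dy).
  rewrite -(subrKA (c x')) rpredD // -(subrKA (c y')) rpredD //.
  by rewrite -opprB rpredN.
Qed.

End AdicCompactness.

(** * The lattices W_m, L' and W_O and the form B' *)

Section Lattice.
Variables (K : fieldExtType Q2) (m : nat) (W : symplectic_space K m).
Local Notation O := (integers K).
Local Notation sp_b := (sp_b W).

Lemma mpow_sum n (I : finType) (F : I -> K) :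
  (forall i, mpow K n (F i)) -> mpow K n (\sum_i F i).
Proof. by move=> mF; apply: big_ind => // [|x y]; [exact: mpow0|exact: mpowD]. Qed.

(** Ramification index 1: an integer that 2 does not divide is a unit. *)
Lemma integers_unit (a : K) : unramified K -> a \in O -> ~ mpow K 1 a ->
  exists2 b, b \in O & a * b = 1.
Proof. by move=> <- Oa; apply: contra_notP => nb; split. Qed.

HB.instance Definition _ := GRing.ZmodClosed.on (L' W).

Lemma Wm_zmod : zmod_closed (Wm W).
Proof.
split; first by apply/asboolP; exists 0; rewrite ?scaler0 ?rpred0.
move=> _ _ /asboolP[u Wu ->] /asboolP[v Wv ->]; apply/asboolP.
by exists (u - v); rewrite ?rpredB ?scalerBr.
Qed.

HB.instance Definition _ := GRing.isZmodClosed.Build W (Wm W) Wm_zmod.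

(** In symplectic coordinates only the products of an e-coordinate on the left
    with an e*-coordinate on the right contribute to B'. *)
Arguments Defs.sp_b : simpl never.

Lemma B'_coord (a c : 'I_m + 'I_m -> K) :
  B' (\sum_i a i *: sp_b i) (\sum_i c i *: sp_b i) =
  2 * \sum_i a (inl i) * c (inr i).
Proof.
have eX k : sp_e W k \in spX W by rewrite memv_span // codom_f.
have esX k : sp_es W k \in spXs W by rewrite memv_span // codom_f.
have Bb i j : B' (sp_b i) (sp_b j) =
    2 * (if i is inl i' then if j is inr j' then (i' == j')%:R else 0 else 0).
  rewrite /B' /B /Defs.sp_b; case: i => i; case: j => j /=.
  - by rewrite (daddv_pi_out (@sp_direct' _ _ W) (eX j)) linear0.
  - rewrite (daddv_pi_id (sp_direct W)) // (daddv_pi_id (@sp_direct' _ _ W)) //.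
    by rewrite sp_form_ees.
  - by rewrite (daddv_pi_out (@sp_direct' _ _ W) (eX j)) linear0.
  - by rewrite (daddv_pi_out (sp_direct W) (esX i)) linear0l.
rewrite (big_morph (fun u => B' u _) (fun u v => B'Dl u v _) (B'0l _)).
rewrite big_sumType /= [X in _ + X]big1 ?addr0 => [|i _]; last first.
  rewrite (big_morph (fun u => B' _ u) (fun u v => B'Dr u v _) (B'0r _)).
  by rewrite big1 // => j _; rewrite B'Zl B'Zr Bb !mulr0.
rewrite mulr_sumr; apply: eq_bigr => i _.
rewrite (big_morph (fun u => B' _ u) (fun u v => B'Dr u v _) (B'0r _)).
rewrite big_sumType /= big1 ?add0r => [|j _]; last first.
  by rewrite B'Zl B'Zr Bb !mulr0.
rewrite (bigD1 i) //= big1 ?addr0 => [|j /negPf ij]; last first.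
  by rewrite B'Zl B'Zr Bb eq_sym ij !mulr0.
by rewrite B'Zl B'Zr Bb eqxx mulr1 mulrA mulrC.
Qed.

Lemma L'P (w : W) : reflect
  (exists a : 'I_m + 'I_m -> K, [/\ forall i, a i \in O,
     forall i, mpow K 1 (a (inl i)) & w = \sum_i a i *: sp_b i])
  (w \in L' W).
Proof.
apply: (iffP (asboolP _)) => [[a Oa ->]|[a [Oa ma ->]]].
  exists (fun i => if i is inl _ then 2 * a i else a i); split.
  - by case=> i //; rewrite rpredM ?rpred_nat.
  - by move=> i; exists (a (inl i)); [exact: Oa|rewrite expr1].
  - by apply: eq_bigr => -[i|i] _ //=; rewrite scalerA mulrC.
have /choice[c cP] : forall i, exists c, c \in O /\ a (inl i) = 2 * c.
  by move=> i; have [c Oc <-] := ma i; exists c.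
exists (fun i => match i with inl i => c i | inr _ => a i end).
  by case=> i //; have [] := cP i.
apply: eq_bigr => -[i|i] _ //=; have [_ ->] := cP i.
by rewrite scalerA mulrC.
Qed.

Lemma L'_WO : {subset L' W <= WO W}.
Proof. by move=> w /L'P[a [Oa _ ->]]; apply/asboolP; exists a. Qed.

Lemma Wm_L' : {subset Wm W <= L' W}.
Proof.
move=> _ /asboolP[_ /asboolP[a Oa ->] ->]; apply/L'P.
exists (fun i => 2 * a i); split=> [i|i|]; first by rewrite rpredM ?rpred_nat.
  by exists (a (inl i)); [exact: Oa|rewrite expr1].
by rewrite scaler_sumr; apply: eq_bigr => i _; rewrite scalerA.
Qed.

Lemma WO_muln (w : W) : w \in WO W -> w *+ 2 \in Wm W.
Proof. by move=> Ow; apply/asboolP; exists w; rewrite // scaler_nat. Qed.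

Lemma B'_L' l w : l \in L' W -> w \in WO W -> mpow K 2 (B' l w).
Proof.
move=> /L'P[a [Oa ma ->]] /asboolP[c Oc ->]; rewrite B'_coord mulr_sumr.
apply: mpow_sum => i; have [b Ob <-] := ma i.
by exists (b * c (inr i)); [exact: rpredM (Oc _)|rewrite expr1; ring].
Qed.

Lemma B'_Wm w u : w \in WO W -> u \in Wm W -> mpow K 2 (B' w u).
Proof.
move=> /asboolP[a Oa ->] /asboolP[_ /asboolP[c Oc ->] ->].
rewrite B'Zr B'_coord; exists (\sum_i a (inl i) * c (inr i)); last by ring.
by apply: rpred_sum => i _; exact: rpredM (Oa _) (Oc _).
Qed.

(** Some e-coordinate a of w is a unit; the vector e* dual to it, multiplied by
    c / a, lies in L' and pairs with w to 2 c. *)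
Lemma B'_dual_L' w : unramified K -> w \in WO W -> w \notin L' W ->
  forall c, c \in O -> exists2 l, l \in L' W & B' w l = 2 * c.
Proof.
move=> hK /asboolP[a Oa ->] nL' c Oc.
have /existsNP[i /(integers_unit hK (Oa _))[b Ob ab1]] :
    ~ forall i, mpow K 1 (a (inl i)).
  by apply: contraNnot nL' => ma; apply/L'P; exists a.
exists (\sum_j (if j == inr i then c * b else 0) *: sp_b j).
  apply/L'P; exists (fun j => if j == inr i then c * b else 0); split=> // j.
    by case: eqP => _; [exact: rpredM|exact: rpred0].
  exact: mpow0.
rewrite B'_coord (bigD1 i) //= eqxx big1 ?addr0 => [|j /negPf ji].
  by rewrite [a _ * _]mulrCA ab1 mulr1.
have -> : (inr j == inr i :> 'I_m + 'I_m) = (j == i) by [].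
by rewrite ji mulr0.
Qed.

(** The e-coordinates of w are divisible by 2, so that some e*-coordinate is a
    unit. *)
Lemma B'_dual_Wm w : unramified K -> w \in L' W -> w \notin Wm W ->
  forall c, c \in O -> exists2 u, u \in WO W & B' u w = 2 * c.
Proof.
move=> hK /L'P[a [Oa ma ->]] nWm c Oc.
have /existsNP[i /(integers_unit hK (Oa _))[b Ob ab1]] :
    ~ forall i, mpow K 1 (a (inr i)).
  apply: contraNnot nWm => ma'.
  have /choice[d dP] : forall i, exists d, d \in O /\ a i = 2 * d.
    by case=> i; [have [d Od <-] := ma i|have [d Od <-] := ma' i]; exists d.
  apply/asboolP; exists (\sum_i d i *: sp_b i).
    by apply/asboolP; exists d => // i; have [] := dP i.
  rewrite scaler_sumr; apply: eq_bigr => j _; rewrite scalerA.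
  by have [_ ->] := dP j.
exists (\sum_j (if j == inl i then c * b else 0) *: sp_b j).
  apply/asboolP; exists (fun j => if j == inl i then c * b else 0) => // j.
  by case: eqP => _; [exact: rpredM|exact: rpred0].
rewrite B'_coord (bigD1 i) //= eqxx big1 ?addr0 => [|j /negPf ji].
  by rewrite -mulrA [b * _]mulrC ab1 mulr1.
have -> : (inl j == inl i :> 'I_m + 'I_m) = (j == i) by [].
by rewrite ji mul0r.
Qed.

(** The coset w0 + 2 W_O is closed, hence compact like A, and w |-> (w - w0) / 2 maps it
    continuously onto W_O. *)
Lemma WO_compact_of_coset (w0 : W) (A : set (adic_space (WO W))) : 2 != 0 :> K ->
  compact A -> (forall u, u \in Wm W -> A (w0 + u)) ->
  compact ([set` WO W] : set (adic_space (WO W))).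
Proof.
move=> two cA hA; pose phi (w : W) : W := 2^-1 *: (w - w0).
have -> : [set` WO W] = phi @` [set w | w - w0 \in Wm W].
  apply/seteqP; split=> [w Ow|_ [w /asboolP[u Wu e] <-]]; last first.
    by rewrite /phi /= e scalerA mulVf ?scale1r.
  exists (w0 + 2 *: w); rewrite /phi /= addrAC subrr add0r.
    by apply/asboolP; exists w.
  by rewrite scalerA mulVf ?scale1r.
apply: (continuous_compact (T := adic_space (WO W)) (U := adic_space (WO W))).
  apply: continuous_subspaceT; apply/adic_continuousP => w n.
  exists n.+1 => l Ol; exists l => //; rewrite /phi addrAC scalerDr; congr (_ + _).
  by rewrite expnSr mulrnA -[(l *+ _) *+ 2]scaler_nat scalerA mulVf ?scale1r.
apply: subclosed_compact cA _ => [|w /= Ww].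
  apply: (@adic_closed _ _ _ 1) => u l Ol; rewrite /= addrAC => h.
  by rewrite -(addrK (l *+ 2 ^ 1) (u - w0)) rpredB // WO_muln.
by rewrite -(subrK w0 w) addrC; exact: hA.
Qed.

End Lattice.

(** * Projective extension of a representation with scalar commutant *)

Section ProjectiveExtension.
Variables (P H : groupType) (a : raction P H) (F : fieldType) (V : lmodType F).
Variable Pi : H -> {linear V -> V}.

Definition intertwines (p : P) (T : V -> V) : Prop :=
  forall h v, Pi h (T v) = T (Pi (a h p) v).

Definition irreducible_rep : Prop :=
  forall S : V -> Prop,
    (forall c u v, S u -> S v -> S (c *: u + v)) ->
    (forall h v, S v -> S (Pi h v)) ->
    (exists2 v, S v & v != 0) -> forall v, S v.

Definition scalar_commutant : Prop :=
  forall S : {linear V -> V}, (forall h v, Pi h (S v) = S (Pi h v)) ->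
    exists c, forall v, S v = c *: v.

(** Schur's lemma: the kernel and the image of T are stable under Pi, because
    every h is the image under p of some element of H. *)
Lemma intertwines_bij p (T : {linear V -> V}) :
  irreducible_rep -> intertwines p T -> (exists v, T v != 0) -> bijective T.
Proof.
move=> irr iT [v0 Tv0].
have injT : injective T.
  move=> u v uv; apply/eqP; rewrite -subr_eq0; apply: contraT => uv0.
  suff T0 v' : T v' = 0 by rewrite T0 eqxx in Tv0.
  apply: (irr (fun v => T v = 0)) => [c x y|h x Tx|].
  - by rewrite linearP => -> ->; rewrite scaler0 addr0.
  - have -> : h = a (a h p^-1%g) p by rewrite -ractM mulVg ract1.
    by rewrite -iT Tx linear0.
  - by exists (u - v); rewrite // linearB uv subrr.
have /choice[T' T'K] : forall v, exists u, T u = v.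
  apply: (irr (fun v => exists u, T u = v)) => [c x y [u <-] [v <-]|h x [u <-]|].
  - by exists (c *: u + v); rewrite linearP.
  - by exists (Pi (a h p) u); rewrite iT.
  - by exists (T v0) => //; exists v0.
by exists T' => // v; apply: injT; rewrite T'K.
Qed.

(** S o T^-1 commutes with Pi. *)
Lemma intertwines_scalar p (S T : {linear V -> V}) :
    scalar_commutant -> intertwines p S -> intertwines p T ->
    bijective S -> bijective T ->
  exists2 c, c != 0 & forall v, S v = c *: T v.
Proof.
move=> schur iS iT bS [T' TK T'K].
pose T'_lin := GRing.isLinear.Build F V V _ T' (can2_linear TK T'K).
pose T'L : {linear V -> V} := HB.pack T' T'_lin.
have [|c cP] := schur (S \o T'L : {linear V -> V}).
  move=> h v; change (Pi h (S (T' v)) = S (T' (Pi h v))).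
  by rewrite iS -[Pi _ (T' v)]TK -iT T'K.
have SE v : S v = c *: T v by have /= := cP (T v); rewrite TK.
(* c = 0 occurs only on the zero module, where the scalar 1 works as well *)
have [c0|] := eqVneq c 0; last by exists c.
have V0 (v : V) : v = 0.
  by apply: (bij_inj bS); rewrite !SE c0 !scale0r.
by exists 1; [exact: oner_neq0|move=> v; rewrite (V0 v) (V0 (S _)) (V0 (_ *: _))].
Qed.

(** Choosing an intertwining operator T p for every p, with T 1 = id, the
    operators T p o Pi h multiply up to a scalar, because T (p p') and
    T p o T p' intertwine the same pair of representations. *)
Lemma projective_extension :
    (forall v, Pi 1%g v = v) ->
    (forall h h' v, Pi (h * h')%g v = Pi h (Pi h' v)) ->
    scalar_commutant ->
    (forall p, exists2 T : {linear V -> V}, bijective T & intertwines p T) ->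
  exists rho : semidirect a -> {linear V -> V},
    projective_representation rho /\
    forall h v, rho (sd_inr a h) v = Pi h v.
Proof.
move=> Pi1 PiM schur ex.
have /choice[T TP] : forall p, exists T : {linear V -> V},
    [/\ bijective T, intertwines p T & p = 1%g -> forall v, T v = v].
  move=> p; have [->|p1] := pselect (p = 1%g); last first.
    by have [T bT iT] := ex p; exists T.
  exists (idfun : {linear V -> V}); split=> [|h v|//].
    by exists id.
  by rewrite /= ract1.
have bPi h : bijective (Pi h).
  by exists (Pi h^-1%g) => v; rewrite -PiM ?mulVg ?mulgV Pi1.
exists (fun x => (T x.1 \o Pi x.2 : {linear V -> V})); split; last first.
  by move=> h v /=; have [_ _ ->] := TP 1%g.
split=> [x|[p h] [p' h']].
  by have [bT _ _] := TP x.1; exact: (bij_comp bT (bPi x.2)).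
have [bT iT _] := TP p; have [bT' iT' _] := TP p'.
have [bT'' iT'' _] := TP (p * p')%g.
have iTT' : intertwines (p * p')%g (T p \o T p').
  by move=> k v; rewrite /= iT iT' ractM.
have [c c0 cP] := intertwines_scalar
  (S := T (p * p')%g) (T := (T p \o T p' : {linear V -> V}))
  schur iT'' iTT' bT'' (bij_comp bT bT').
by exists c => // v; rewrite /= PiM cP /= iT'.
Qed.

End ProjectiveExtension.

(** * The representation of the Heisenberg group on V_psi *)

Section SubspaceVpsi.
Variables (R : realType) (K : fieldExtType Q2) (m : nat).
Variables (W : symplectic_space K m) (Psi : K -> R[i]).
Hypotheses (hK : unramified K) (hPsi : is_character Psi) (hlevel : level_m2 Psi).
Local Notation C := R[i].
Local Notation O := (integers K).
Local Notation WO := (WO W).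
Local Notation Wm := (Wm W).
Local Notation L' := (L' W).
Local Notation Vpsi := (Vpsi W Psi).
Local Notation Pi' := (@Pi' R K m W Psi).

Let PsiD x y : Psi (x + y) = Psi x * Psi y. Proof. by have [] := hPsi. Qed.

Let Psi0 : Psi 0 = 1.
Proof. by apply: hlevel.1; exact: mpow0. Qed.

Let Psi_m2 x : mpow K 2 x -> Psi x = 1. Proof. exact: hlevel.1. Qed.

(** If 2 were 0 then m would be 0, where Psi is trivial. *)
Lemma level_two_neq0 : 2 != 0 :> K.
Proof.
have [_ [_ [y _ <-]]] := hlevel; apply: contraNneq => two0.
by rewrite expr1 two0 mul0r Psi0.
Qed.

(** On W_O the factor Psi (- B' l w) in the definition of S_L' is 1, so that V_psi
    consists of the functions supported on W_O that are invariant under L'. *)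
Definition L'_invariant (f : W -> C^o) : Prop :=
  (forall l w, l \in L' -> w \in WO -> f (l + w) = f w) /\
  (forall w, w \notin WO -> f w = 0).

Lemma Vpsi_invariant (f : W -> C^o) : f \in V_psi Psi -> L'_invariant f.
Proof.
move=> /asboolP[[_ _ fe] f0]; split=> // l w Ll Ow.
by rewrite fe // Psi_m2 ?mul1r //; exact/mpowN/B'_L'.
Qed.

(** By L'-invariance the support of f contains w0 + 2 W_O. *)
Lemma Vpsi_WO_compact (f : W -> C^o) w0 : f \in V_psi Psi -> f w0 != 0 ->
  compact ([set` WO] : set (adic_space WO)).
Proof.
move=> Vf fw0; have [/asboolP[[_ cf _] _] [fL f0]] := (Vf, Vpsi_invariant Vf).
have Ow0 : w0 \in WO by apply: contraNT fw0 => /f0 ->.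
apply: (WO_compact_of_coset (w0 := w0) level_two_neq0 cf) => u Wu.
by apply: subset_closure; rewrite /= addrC fL //; exact: Wm_L'.
Qed.

Lemma invariant_Vpsi f : compact ([set` WO] : set (adic_space WO)) ->
  L'_invariant f -> f \in V_psi Psi.
Proof.
move=> cO [fL f0]; have fO w : f w != 0 -> w \in WO.
  by apply: contraNT => /f0 ->.
have WOl w l : l \in L' -> (l + w \in WO) = (w \in WO).
  by move=> Ll; rewrite rpredDl //; exact: L'_WO.
apply/asboolP; split=> //; split.
- move=> w; apply/adic_nbhsP; exists 1%N => l Ol.
  have Ll : l *+ 2 ^ 1 \in L' by exact/Wm_L'/WO_muln.
  have [Ow|nOw] := boolP (w \in WO); first by rewrite addrC fL.
  by rewrite !f0 // addrC WOl.
- apply: (subclosed_compact _ cO); first exact: closed_closure.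
  rewrite closureE; apply: smallest_sub => [|w /= /fO //].
  apply: (@adic_closed _ _ _ 0) => u l Ol; rewrite /= expn0 mulr1n => Oul.
  by rewrite -(addrK l u) rpredB.
- move=> l w Ll; have [Ow|nOw] := boolP (w \in WO).
    by rewrite fL // Psi_m2 ?mul1r //; exact/mpowN/B'_L'.
  by rewrite !f0 ?mulr0 // WOl.
Qed.

Lemma Pi'_invariant h f : h \in heisO W -> L'_invariant f ->
  L'_invariant (Pi' h f).
Proof.
move=> /andP[Oh _] [fL f0]; split=> [l w Ll Ow|w nOw]; rewrite /Pi'.
  rewrite -addrA (fL l (w + h.1)) ?rpredD // B'Dl addrCA (PsiD (B' l _)).
  by rewrite (Psi_m2 (B'_L' Ll Oh)) mul1r.
by rewrite f0 ?mulr0 // rpredDr.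
Qed.

Lemma Pi'M h h' f : Pi' (heis_mul h h') f = Pi' h (Pi' h' f).
Proof.
apply/funext => w; rewrite /Pi' /= addrA mulrA -PsiD; congr (Psi _ * _).
by rewrite B'Dl B'Dr; ring.
Qed.

Lemma Pi'1 f : Pi' (heis_one W) f = f.
Proof. by apply/funext => w; rewrite /Pi' /= B'0r !addr0 Psi0 mul1r. Qed.

Lemma Pi'_linear h : linear (Pi' h).
Proof.
by move=> c f g; apply/funext => w; rewrite /Pi' !fctE mulrDr scalerAr.
Qed.

Lemma Pi'_sum h (I : Type) (r : seq I) (P : pred I) (F : I -> W -> C^o) w :
  Pi' h (\sum_(i <- r | P i) F i) w = \sum_(i <- r | P i) Pi' h (F i) w.
Proof. by rewrite /Pi' fct_sumE mulr_sumr. Qed.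

Lemma Pi'_center w t t' f : Pi' (w, t + t') f = Psi t' *: Pi' (w, t) f.
Proof.
apply/funext => z; rewrite /Pi' /= addrAC PsiD fctE.
by rewrite [_ * Psi t']mulrC -mulrA.
Qed.

(** The kernel of the representation contains W_m x m^2, so that all operators
    below only depend on classes modulo W_m. *)
Lemma Pi'_Wm u t f : u \in Wm -> mpow K 2 t -> L'_invariant f ->
  Pi' (u, t) f = f.
Proof.
move=> Wu mt [fL f0]; apply/funext => w; rewrite /Pi' /=.
have [Ow|nOw] := boolP (w \in WO); last first.
  by rewrite !f0 ?mulr0 // rpredDr //; exact/L'_WO/Wm_L'.
rewrite [w + u]addrC fL //; last exact: Wm_L'.
rewrite Psi_m2 ?mul1r //.
by apply: mpowD => //; exact: B'_Wm.
Qed.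

Lemma Vpsi_lift (T : (W -> C^o) -> (W -> C^o)) : linear T ->
    (forall f : W -> C^o, f \in V_psi Psi -> T f \in V_psi Psi) ->
  exists T' : {linear Vpsi -> Vpsi}, forall v, Vpsi_val (T' v) = T (Vpsi_val v).
Proof.
move=> lT VT; pose T0 (v : Vpsi) : Vpsi := MkVpsi (VT _ (valP v)).
have T0l : linear T0 by move=> c u v; apply/val_inj; exact: lT.
pose T0L := GRing.isLinear.Build C Vpsi Vpsi _ T0 T0l.
pose T' : {linear Vpsi -> Vpsi} := HB.pack T0 T0L.
by exists T'.
Qed.

Lemma Vpsi_neq0 (v : Vpsi) : v != 0 -> exists w, Vpsi_val v w != 0.
Proof.
apply: contraNP => /forallNP v0; apply/eqP/val_inj/funext => w.
exact/eqP/negPn/negP/v0.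
Qed.

Section Averages.
Variable s : seq W.
Hypothesis ts : coset_reps (Wm : zmodClosed W) WO s.

Definition vacuum_projection (f : W -> C^o) : W -> C^o :=
  \sum_(l <- s | l \in L') Pi' (l, 0) f.

Definition vacuum (w : W) : C^o := (w \in L')%:R.

Let k := size [seq l <- s | l \in L'].

Let tsL : coset_reps (Wm : zmodClosed W) L' [seq l <- s | l \in L'].
Proof.
exact: (coset_reps_filter (E := L') (D := WO) (@Wm_L' _ _ _) (@L'_WO _ _ _) ts).
Qed.

Let k_neq0 : k%:R != 0 :> C.
Proof. exact: (coset_reps_size _ (D := L') tsL). Qed.

(** At w the sum is f w times the sum over L' / W_m of the character
    l |-> Psi (B' w l), which is trivial exactly when w lies in L'. *)
Lemma vacuum_projectionE f : L'_invariant f ->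
  vacuum_projection f = (k%:R * f 0) *: (vacuum : W -> C^o).
Proof.
move=> [fL f0]; apply/funext => w; rewrite /vacuum_projection fct_sumE fctE.
have [Ow|nOw] := boolP (w \in WO); last first.
  rewrite /vacuum (contraNF (@L'_WO _ _ _ w) nOw) scaler0 big1 // => l Ll.
  by rewrite /Pi' /= f0 ?mulr0 // rpredDr //; exact: L'_WO.
transitivity ((\sum_(l <- [seq l <- s | l \in L']) Psi (B' w l)) * f w).
  rewrite big_filter mulr_suml; apply: eq_bigr => l Ll.
  by rewrite /Pi' /= add0r [w + l]addrC fL.
rewrite /vacuum; have [Lw|nLw] := boolP (w \in L').
  have -> : f w = f 0 by rewrite -{1}[w]addr0 fL ?rpred0.
  rewrite (eq_big_seq (fun=> 1)) ?sumr_const_seq.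
    by rewrite big_const_seq count_predT iter_addr_0 [RHS]mulr1.
  move=> l; rewrite mem_filter => /andP[Ll _].
  by apply/Psi_m2/B'_L' => //; exact: L'_WO.
rewrite scaler0; have [_ [_ [c Oc <-] Psic]] := hlevel.
have [l Ll Bwl] := B'_dual_L' hK Ow nLw Oc.
rewrite (coset_reps_char_sum (D := L') (u := l) tsL) ?mul0r //.
- exact: Wm_L'.
- by move=> x y _ _; rewrite B'Dr PsiD.
- by move=> u Wu; apply/Psi_m2/B'_Wm.
- by rewrite Bwl -[2 * c]/(2 ^+ 1 * c).
Qed.

(** The translate of the vacuum by the inverse of (x, 0) is the indicator function
    of x + L', because the phase B' x x of that inverse cancels the one that Pi'
    produces on x + L'.  As x runs over W_O / W_m, each coset of L' is counted
    k times. *)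
Lemma vacuum_span g : L'_invariant g ->
  k%:R *: g = \sum_(x <- s) g x *: Pi' (heis_inv (x, 0)) vacuum.
Proof.
move=> [gL g0]; apply/funext => w; rewrite fct_sumE !fctE.
have [us sO _ _] := ts.
have [Ow|nOw] := boolP (w \in WO); last first.
  rewrite g0 // scaler0 big1_seq // => x /andP[_ /sO Ox].
  rewrite fctE /Pi' /vacuum /= (contraNF (@L'_WO _ _ _ (w - x))) ?mulr0 ?scaler0 //.
  by rewrite rpredBr.
(* only the x in w + L' contribute, and g x = g w for them *)
transitivity (\sum_(x <- s) (g w * (x - w \in L')%:R)).
  rewrite -mulr_sumr mulrC; congr (_ * _).
  rewrite (coset_reps_shift (F := fun x => (x \in L')%:R) (D := WO) ts).
  - rewrite /k size_filter -sum1_count natr_sum big_mkcond.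
    by apply: eq_bigr => x _; case: (x \in L').
  - by rewrite rpredN.
  - by move=> x l _ Wl; rewrite rpredDr //; exact: Wm_L'.
rewrite big_seq [RHS]big_seq; apply: eq_bigr => x /sO Ox.
rewrite fctE /Pi' /vacuum /= -[w - x]opprB rpredN.
have [Lxw|_] := boolP (x - w \in L'); last first.
  by rewrite !mulr0 scaler0.
rewrite -[in g x](subrK w x) gL //; congr (_ * _); rewrite mulr1.
rewrite oppr0 add0r B'Nr -B'Nl -B'Dl.
by rewrite Psi_m2 //; exact: B'_L'.
Qed.

(** * Intertwining operators between the representation and its twists *)

Section Twist.
Variable p : PsO W.
Local Notation alpha := (fun h : Heis W => Ps_act h (PsO_val p) : Heis W).

Let alphaM h h' : alpha (heis_mul h h') = heis_mul (alpha h) (alpha h').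
Proof.
have [[_ _ e] _ _ _ _] := PsOP p.
rewrite /Ps_act; congr pair => /=; first by rewrite linearD.
move: (e h.1 h'.1) => /(canRL (subrK _))/(canRL (subrK _)) ->; ring.
Qed.

Let alpha_heisO h : h \in heisO W -> alpha h \in heisO W.
Proof. by move=> Oh; exact: (Ps_act_subproof (MkHeisO Oh) p). Qed.

Let wO w : w \in WO -> (w, 0) \in heisO W.
Proof. by move=> Ow; apply/andP; split=> //; exact: rpred0. Qed.

Let twist_center w t t' f :
  Pi' (alpha (w, t + t')) f = Psi t' *: Pi' (alpha (w, t)) f.
Proof. by rewrite /Ps_act /= addrAC Pi'_center. Qed.

Let twistD w w' f : Psi (B' w w') *: Pi' (alpha (w + w', 0)) f =
  Pi' (alpha (w, 0)) (Pi' (alpha (w', 0)) f).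
Proof. by rewrite -Pi'M -alphaM /heis_mul /= addr0 twist_center. Qed.

Let twist_id u f : u \in Wm -> L'_invariant f -> Pi' (alpha (u, 0)) f = f.
Proof.
have [_ gWO _ qm _] := PsOP p; move=> Wu fI.
by apply: Pi'_Wm => //; [exact: Wm_stab|rewrite add0r; exact: qm].
Qed.

Let twist_Wm w u f : w \in WO -> u \in Wm -> L'_invariant f ->
  Pi' (alpha (w + u, 0)) f = Pi' (alpha (w, 0)) f.
Proof.
move=> Ow Wu fI.
rewrite -[LHS]scale1r -(Psi_m2 (B'_Wm Ow Wu)) twistD.
by congr (Pi' _ _); exact: twist_id.
Qed.

(** With sigma = Pi' o alpha, the functional f |-> sum_l (sigma (l, 0) f) x0 is
    fixed by L'.  By Frobenius reciprocity it defines an operator from sigma to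
    Pi', which is induced from L' x O: evaluate it on sigma (z, 0) f. *)
Definition twisted_coefficient (x0 : W) (f : W -> C^o) : W -> C^o :=
  fun z => if z \in WO then
    \sum_(l <- s | l \in L') Pi' (alpha (l + z, 0)) f x0 else 0.

Lemma twisted_coefficient_linear x0 : linear (twisted_coefficient x0).
Proof.
move=> c f g; apply/funext => z; rewrite /twisted_coefficient !fctE.
case: ifP => _; last by rewrite scaler0 addr0.
rewrite scaler_sumr -big_split; apply: eq_bigr => l _.
by rewrite Pi'_linear.
Qed.

Lemma twisted_coefficient_invariant x0 f :
  L'_invariant f -> L'_invariant (twisted_coefficient x0 f).
Proof.
move=> fI; rewrite /twisted_coefficient; split=> [u w Lu Ow|w /negPf -> //].
rewrite Ow rpredD ?(L'_WO Lu) // -[LHS]big_filter -[RHS]big_filter.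
pose F l := Pi' (alpha (l + w, 0)) f x0.
transitivity (\sum_(l <- [seq l <- s | l \in L']) F (l + u)).
  by apply: eq_bigr => l _; rewrite /F addrA.
apply: (coset_reps_shift (D := L') tsL Lu) => l v Ll Wv.
by rewrite /F addrAC (twist_Wm _ Wv fI) //; apply: rpredD => //; exact: L'_WO.
Qed.

Lemma twisted_coefficient_intertwines x0 h f : h \in heisO W -> L'_invariant f ->
  Pi' h (twisted_coefficient x0 f) = twisted_coefficient x0 (Pi' (alpha h) f).
Proof.
case: h => w t /andP[/= Ow _] fI; apply/funext => z.
rewrite {1}/Pi' /twisted_coefficient /=.
rewrite rpredDr //; case: ifPn => [Oz|_]; last by rewrite mulr0.
rewrite mulr_sumr; apply: eq_bigr => l Ll.
rewrite -Pi'M -alphaM /heis_mul /= -[0 + t + _]addrA twist_center fctE.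
rewrite B'Dl [t + (_ + _)]addrCA (PsiD (B' l w)) (Psi_m2 (B'_L' Ll Ow)).
by rewrite mul1r addrA.
Qed.

(** Conjugating the sum of the sigma (l, 0) by sigma (x, 0) multiplies the term of
    index l by Psi (- B' x l).  Summed over x in W_O / W_m these factors kill all
    terms but the one with l in W_m, which is the identity.  So f would be 0 if
    all the operators were. *)
Lemma twisted_coefficient_neq0 f : L'_invariant f -> f != 0 ->
  exists x0 f', L'_invariant f' /\ twisted_coefficient x0 f' != 0.
Proof.
move=> fI; apply: contraNP => /forallNP T0.
have [us sO _ _] := ts.
(* by T0 the sum of the sigma (l, 0) kills every invariant function *)
have average0 z x : x \in WO -> \sum_(l <- s | l \in L')
    Psi (- B' x l) * Pi' (alpha (l, 0)) f z = 0.
  move=> Ox.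
  have Q0 : \sum_(l <- s | l \in L')
      Pi' (alpha (l, 0)) (Pi' (alpha (x, 0)) f) = 0.
    apply/funext => x0; rewrite fct_sumE.
    have fxI : L'_invariant (Pi' (alpha (x, 0)) f).
      by apply: Pi'_invariant fI; exact/alpha_heisO/wO.
    have /forallNP/(_ (Pi' (alpha (x, 0)) f)) /not_andP[//|] := T0 x0.
    move/negP/negPn/eqP/(congr1 (fun g : W -> C^o => g 0)).
    rewrite /twisted_coefficient rpred0 => Q00; etransitivity; last exact: Q00.
    by apply: eq_bigr => l _; rewrite addr0.
  have := Pi'_sum (alpha (heis_inv (x, 0))) s (fun l => l \in L')
    (fun l => Pi' (alpha (l, 0)) (Pi' (alpha (x, 0)) f)) z.
  rewrite Q0 [LHS]mulr0 => e; rewrite [RHS]e; apply: eq_bigr => l Ll.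
  rewrite -!Pi'M -!alphaM /heis_mul /heis_inv /=.
  have -> : - x + l + x = l by rewrite addrC addNKr.
  rewrite B'Dl !B'Nl.
  have -> : - 0 + B' x x + 0 + - B' x l + 0 + (- B' x x + B' l x) =
      0 + (B' l x + - B' x l) by ring.
  by rewrite twist_center PsiD (Psi_m2 (B'_L' Ll Ox)) mul1r.
have csum l : l \in L' ->
    \sum_(x <- s) Psi (- B' x l) = (size s)%:R * (l \in Wm)%:R.
  move=> Ll; have [Wl|nWl] := boolP (l \in Wm).
    rewrite mulr1 big_seq (eq_bigr (fun=> 1)) => [|x /sO Ox].
      by rewrite -big_seq big_const_seq count_predT iter_addr_0.
    by rewrite Psi_m2 //; exact/mpowN/B'_Wm.
  rewrite mulr0; have [_ [_ [c Oc <-] Psic]] := hlevel.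
  have Onc : - c \in O by rewrite rpredN.
  have [u Ou Bul] := B'_dual_Wm hK Ll nWl Onc.
  apply: (coset_reps_char_sum (D := WO) (u := u) ts) => //.
  - by move=> v Wv; exact/L'_WO/Wm_L'.
  - by move=> v v' _ _; rewrite B'Dl opprD PsiD.
  - by move=> v Wv; apply/Psi_m2/mpowN/B'_L' => //; [exact: Wm_L'|exact: L'_WO].
  - by rewrite Bul mulrN opprK -[2 * c]/(2 ^+ 1 * c).
have tsW := coset_reps_filter (E := Wm) (D := L') (fun x => id) (@Wm_L' _ _ _) tsL.
apply/eqP/funext => z; apply/eqP.
have : \sum_(x <- s) \sum_(l <- s | l \in L')
    Psi (- B' x l) * Pi' (alpha (l, 0)) f z = 0.
  by rewrite big1_seq // => x /andP[_ /sO]; exact: average0.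
rewrite exchange_big /= (eq_bigr (fun l => (size s)%:R * f z * (l \in Wm)%:R)).
  rewrite -mulr_sumr -big_filter => /eqP; rewrite !mulf_eq0.
  rewrite (negbTE (coset_reps_size _ (D := WO) ts)) /= => /orP[//|].
  have -> : \sum_(l <- [seq l <- s | l \in L']) (l \in Wm)%:R =
      (size [seq l <- [seq l <- s | l \in L'] | l \in Wm])%:R :> C.
    rewrite size_filter -sum1_count natr_sum [RHS]big_mkcond.
    by apply: eq_bigr => l _; case: (l \in Wm).
  by rewrite (negbTE (coset_reps_size _ (D := Wm) tsW)).
move=> l Ll; rewrite -mulr_suml csum //.
have [Wl|_] := boolP (l \in Wm); last by rewrite !mulr0 mul0r.
by rewrite twist_id // !mulr1.
Qed.

End Twist.

(** * Irreducibility, scalar commutant and conclusion *)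

Section Operators.
Hypothesis cO : compact ([set` WO] : set (adic_space WO)).
Variable Pi : HeisO W -> {linear Vpsi -> Vpsi}.
Hypothesis PiE : forall h v, Vpsi_val (Pi h v) = Pi' (val h) v.

Let VpsiI (v : Vpsi) : L'_invariant v := Vpsi_invariant (valP v).

Lemma vacuum_invariant : L'_invariant vacuum.
Proof.
split=> [l w Ll _|w nOw]; first by rewrite /vacuum rpredDl.
by rewrite /vacuum (contraNF (@L'_WO _ _ _ w) nOw).
Qed.

Let vac : Vpsi := MkVpsi (invariant_Vpsi cO vacuum_invariant).

Let heisO_at (w : W) : HeisO W := insubd (1%g : HeisO W) (w, 0).

Let heisO_atE w : w \in WO -> val (heisO_at w) = (w, 0).
Proof.
by move=> Ow; rewrite val_insubd ifT //; apply/andP; split=> //; exact: rpred0.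
Qed.

Let Vpsi_sumE (I : Type) (r : seq I) (P : pred I) (F : I -> Vpsi) :
  Vpsi_val (\sum_(i <- r | P i) F i) = \sum_(i <- r | P i) Vpsi_val (F i).
Proof. exact: (big_morph (@Vpsi_val R K m W Psi)). Qed.

Let proj (v : Vpsi) : Vpsi := \sum_(l <- s | l \in L') Pi (heisO_at l) v.

Let proj_translate x v : x \in WO ->
  proj (Pi (heisO_at x) v) = (k%:R * Vpsi_val v x) *: vac.
Proof.
move=> Ox; apply/val_inj; rewrite /= Vpsi_sumE.
transitivity (vacuum_projection (Pi' (x, 0) v)).
  apply: eq_bigr => l Ll; rewrite PiE PiE !heisO_atE //; exact: L'_WO.
rewrite vacuum_projectionE; last first.
  by apply: Pi'_invariant => //; apply/andP; split=> //; exact: rpred0.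
by rewrite /Pi' /= B'0l !add0r Psi0 mul1r.
Qed.

(** The value of v at x is the coefficient of the vacuum in the projection of the
    x-translate of v, so an operator commuting with the representation is
    determined by its value on the vacuum, at which it acts by a scalar. *)
Lemma Vpsi_scalar_commutant : scalar_commutant Pi.
Proof.
move=> S SPi; exists (Vpsi_val (S vac) 0) => v.
apply/val_inj/funext => x; rewrite /= fctE.
have [Ox|nOx] := boolP (x \in WO); last first.
  by rewrite !(proj2 (VpsiI _) x nOx) scaler0.
have : proj (Pi (heisO_at x) (S v)) = S (proj (Pi (heisO_at x) v)).
  by rewrite /proj linear_sum; apply: eq_bigr => l _; rewrite !SPi.
rewrite !proj_translate // linearZ.
move/(congr1 (fun u : Vpsi => Vpsi_val u 0)).
rewrite /= !fctE /vacuum rpred0 -[LHS]/(_ * _) -[RHS]/(_ * _) mulr1 -mulrA.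
by move/(mulfI k_neq0) => ->; rewrite mulrC.
Qed.

(** Projecting a translate of a non-zero vector gives the vacuum, whose translates
    span V_psi. *)
Lemma Vpsi_irreducible : irreducible_rep Pi.
Proof.
move=> S SP SPi [v Sv v0] g.
have S0 : S 0 by rewrite -(addNr v) -scaleN1r; exact: SP.
have SZ c u : S u -> S (c *: u) by move=> Su; rewrite -[_ *: _]addr0; exact: SP.
have SS (F : W -> Vpsi) (P : pred W) :
    (forall x, x \in s -> P x -> S (F x)) -> S (\sum_(x <- s | P x) F x).
  move=> SF; rewrite big_seq_cond; apply: big_ind => // [a b Sa Sb|x /andP[]].
    by rewrite -[a]scale1r; exact: SP.
  exact: SF.
have [x vx] := Vpsi_neq0 v0.
have Ox : x \in WO by apply: contraNT vx => /(proj2 (VpsiI v)) ->.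
have Svac : S vac.
  have -> : vac = (k%:R * Vpsi_val v x)^-1 *: proj (Pi (heisO_at x) v).
    by rewrite proj_translate // scalerA mulVf ?scale1r // mulf_neq0.
  by apply/SZ/SS => l _ _; exact/SPi/SPi.
have [_ sO _ _] := ts.
have -> : g = k%:R^-1 *: \sum_(y <- s) Vpsi_val g y *: Pi (heisO_at y)^-1%g vac.
  apply/(scalerI k_neq0)/val_inj; rewrite scalerA mulfV // scale1r /=.
  rewrite (vacuum_span (VpsiI g)) Vpsi_sumE big_seq [RHS]big_seq.
  by apply: eq_bigr => y /sO Oy; rewrite /= PiE -[val _]/(heis_inv (val _)) heisO_atE.
by apply/SZ/SS => y _ _; exact/SZ/SPi.
Qed.

Lemma Vpsi_intertwiner (p : PsO W) : (exists v : Vpsi, v != 0) ->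
  exists2 T : {linear Vpsi -> Vpsi}, bijective T &
    intertwines (PsO_raction W) Pi p T.
Proof.
move=> [v v0].
have vv0 : Vpsi_val v != 0 by [].
have [x0 [f [fI Tf0]]] := twisted_coefficient_neq0 p (VpsiI v) vv0.
have [|T TE] := Vpsi_lift (twisted_coefficient_linear p x0).
  by move=> g /Vpsi_invariant gI; apply/invariant_Vpsi/twisted_coefficient_invariant.
have iT : intertwines (PsO_raction W) Pi p T.
  move=> h u; apply/val_inj; rewrite /= PiE !TE PiE.
  by rewrite twisted_coefficient_intertwines // (valP h).
exists T => //; apply: intertwines_bij Vpsi_irreducible iT _.
exists (MkVpsi (invariant_Vpsi cO fI)); apply: contraNneq Tf0 => T0.
by rewrite -(TE (MkVpsi (invariant_Vpsi cO fI))) T0.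
Qed.

End Operators.

End Averages.

End SubspaceVpsi.

Theorem lemma3p18 (R : realType) (K : fieldExtType Q2) (hK : unramified K)
    (m : nat) (W : symplectic_space K m) (Psi : K -> R[i])
    (hPsi : is_character Psi) (hlevel : level_m2 Psi) :
  exists rho : semidirect (PsO_raction W) ->
               {linear Vpsi W Psi -> Vpsi W Psi},
    projective_representation rho /\
    forall (h : HeisO W) (v : Vpsi W Psi),
      Vpsi_val (rho (sd_inr (PsO_raction W) h) v) = Pi' Psi h v.
Proof.
have [V0|/existsNP[v0 /eqP nv0]] := pselect (forall v : Vpsi W Psi, v = 0).
  exists (fun=> idfun); split; last first.
    move=> h v; rewrite (V0 v) /=; apply/funext => w.
    by rewrite /Pi' [LHS]/(0 : R[i]) [X in _ * X]/(0 : R[i]) mulr0.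
  split=> [_|x y]; first by exists id.
  by exists 1 => [|v]; rewrite ?oner_neq0 ?scale1r.
have [w0 v0w0] := Vpsi_neq0 nv0.
have cO := Vpsi_WO_compact hlevel (valP v0) v0w0.
have [s ts] := compact_coset_reps (n := 1) cO (M := Wm W) (@WO_muln _ _ _).
have /choice[Pi PiE] (h : HeisO W) : exists T : {linear Vpsi W Psi -> Vpsi W Psi},
    forall v, Vpsi_val (T v) = Pi' Psi (val h) v.
  apply: (Vpsi_lift (Pi'_linear Psi (val h))) => f /(Vpsi_invariant hlevel) fI.
  by apply: invariant_Vpsi => //; apply: Pi'_invariant => //; exact: (valP h).
have [|||p|rho [rhoP rhoE]] :=
    @projective_extension _ _ (PsO_raction W) _ _ Pi.
- by move=> v; apply/val_inj; rewrite /= PiE (Pi'1 hlevel).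
- by move=> h h' v; apply/val_inj; rewrite /= !PiE (Pi'M hPsi).
- exact: (Vpsi_scalar_commutant hK hPsi hlevel ts cO PiE).
- by apply: (Vpsi_intertwiner hK hPsi hlevel ts cO PiE); exists v0.
by exists rho; split=> // h v; rewrite rhoE PiE.
Qed.
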